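(* Let $g\in L^2(\mathbb R)$ and $a,b>0$ be such that $G(g,a,b)$ is a Bessel sequence in $L^2(\mathbb R)$, with frame operator $S$. If $g\in X_{1/b}(L^{\infty},\ell^2)\cap X_a(L^{\infty},\ell^2)$, then $$Sf=\frac1b\sum_{n\in\mathbb Z}\langle f,T_{na}g\rangle_{L_{1/b}^{\infty}(\ell^2)}\,T_{na}g,\qquad\forall f\in X_{1/b}(L^{\infty},\ell^2),$$ where this series converges unconditionally in norm in $L^2(\mathbb R)$.
   Context: $T_cf(x)=f(x-c)$, $M_cf(x)=e^{2\pi icx}f(x)$; $G(g,a,b)$ is the family $(M_{mb}T_{na}g)_{m,n\in\mathbb Z}$ in $L^2(\mathbb R)$, and its frame operator is $Sf=\sum_{m,n\in\mathbb Z}\langle f,M_{mb}T_{na}g\rangle_{L^2(\mathbb R)}M_{mb}T_{na}g$. For $c>0$, $L_c^{\infty}(\ell^2)=\{f:\mathbb R\to\mathbb C\text{ measurable}: \operatorname{ess\,sup}_{x\in[0,c]}\sum_{k\in\mathbb Z}|f(x-kc)|^2<\infty\}$, and $X_c(L^{\infty},\ell^2)\subseteq L_c^{\infty}(\ell^2)$ is the set of measurable $f:\mathbb R\to\mathbb C$ such that $\sum_{k\in\mathbb Z}|(T_{-kc}f)\chi_{[0,c]}|^2$ converges in norm in $L^\infty[0,c]$. For $f,h\in L_c^{\infty}(\ell^2)$, $\langle f,h\rangle_{L_c^\infty(\ell^2)}(x)=\sum_{k\in\mathbb Z}f(x-kc)\overline{h(x-kc)}$, an essentially bounded $c$-periodic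 function on $\mathbb R$, which multiplies functions on $\mathbb R$ pointwise. All generators of Gabor Bessel sequences $G(g,a,b)$ lie in $L_{1/b}^\infty(\ell^2)\cap L_a^\infty(\ell^2)$, and these spaces are translation invariant and contained in $L^2(\mathbb R)$. *)

(* Defs.v *)
From HB Require Import structures.
From mathcomp Require Import all_boot all_order all_algebra.
From mathcomp Require Import finmap complex.
From mathcomp Require Import all_classical all_reals all_analysis.
From mathcomp Require Import summability.

Set Implicit Arguments.
Unset Strict Implicit.
Unset Printing Implicit Defensive.

Import Order.TTheory GRing.Theory Num.Theory.
Import numFieldNormedType.Exports.

Local Open Scope classical_set_scope.
Local Open Scope ring_scope.
Local Open Scope complex_scope.

(* Functions are honest functions [R -> R[i]], equality in L^2 being equality
   almost everywhere, and measurability is Borel measurability, the convention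
   of [lebesgue_measure].  Families indexed by [int] or [int * int] are summed
   along the filter [totally] of finite subsets of the index set, ordered by
   inclusion; in a Banach space this is unconditional convergence. *)

Section defs.
Context {R : realType}.
Implicit Types (f g h s : R -> R[i]) (a b c x : R).

Notation mu := (@lebesgue_measure R).

Definition cmeasurable f :=
  measurable_fun [set: R] (fun x => complex.Re (f x)) /\
  measurable_fun [set: R] (fun x => complex.Im (f x)).

Definition cabs (z : R[i]) : R := complex.Re `|z|.

Definition translation c f : R -> R[i] := fun x => f (x - c).

Definition modulation c f : R -> R[i] :=
  fun x => (cos (2 * pi * c * x) +i* sin (2 * pi * c * x)) * f x.

Definition L2norm f : \bar R := Lnorm mu 2%:E (fun x => (cabs (f x))%:E).

Definition L2 f := cmeasurable f /\ (L2norm f < +oo)%E.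

Definition cintegral f : R[i] :=
  Complex (Rintegral mu setT (fun x => complex.Re (f x)))
          (Rintegral mu setT (fun x => complex.Im (f x))).

Definition L2inner f h : R[i] := cintegral (fun x => f x * (h x)^*).

Definition L2_sum {I : choiceType} (u : I -> R -> R[i]) s :=
  [/\ forall i, L2 (u i), L2 s &
    (fun A : {fset I} => L2norm (fun x => partial_sum (fun i => u i x) A - s x))
      @ totally --> 0%E].

Definition gabor g a b (mn : int * int) : R -> R[i] :=
  modulation (mn.1%:~R * b) (translation (mn.2%:~R * a) g).

Definition gabor_bessel g a b :=
  exists2 B : R, 0 < B &
    forall f, L2 f ->
      (\esum_(mn in [set: int * int]) (cabs (L2inner f (gabor g a b mn)) ^+ 2)%:E
       <= B%:E * L2norm f ^+ 2)%E.

(* The sum is determined up to a null set, and [xget] selects a representative. *)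
Definition frame_operator g a b f : R -> R[i] :=
  xget 0 [set s : R -> R[i] | L2_sum
    (fun mn x => L2inner f (gabor g a b mn) * gabor g a b mn x) s].

(* The norm of L^oo[0,c], as the L^oo(R)-norm of the extension by zero. *)
Definition Linf_norm c (F : R -> \bar R) : \bar R :=
  Lnorm mu +oo%E (F \_ `[0, c]).

Definition Linf_l2 c f :=
  cmeasurable f /\
  (Linf_norm c (fun x =>
     \esum_(k in [set: int]) (cabs (f (x - k%:~R * c)%R) ^+ 2)%:E) < +oo)%E.

Definition XLinf_l2 c f :=
  Linf_l2 c f /\
  exists h : R -> R,
    [/\ measurable_fun [set: R] h,
        (Linf_norm c (fun x => (h x)%:E) < +oo)%E &
        (fun A : {fset int} => Linf_norm c (fun x =>
           (partial_sum
              (fun k : int => cabs (translation (- (k%:~R * c)) f x) ^+ 2) A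
            - h x)%:E))
          @ totally --> 0%E].

(* The series converges absolutely at almost every x when f and h belong to
   [Linf_l2 c]; elsewhere [sum] returns a default value. *)
Definition bracket c f h : R -> R[i] :=
  fun x => sum (fun k : int =>
    f (x - k%:~R * c) * (h (x - k%:~R * c))^* : R[i]^o).

End defs.

(* Main.v *)
(* The Bessel property gives, by duality and completeness of L^2, unconditional
   convergence of the double Gabor series.  Unfolding the integral over the line
   along the lattice Z/b shows that, for fixed n, the inner products
   <f, M_mb T_na g> are the Fourier coefficients, over one period, of the
   1/b-periodic function <f, T_na g>_{1/b}, which is essentially bounded.  Its
   Fourier series therefore converges in L^2 over a period, and multiplication
   by T_na g, whose 1/b-periodised square is bounded, turns this into convergence
   in L^2(R) of the inner sum over m to b^-1 <f, T_na g>_{1/b} T_na g.  Summing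
   the double series first over m gives the formula.

   Uniqueness of Fourier coefficients, which identifies the sum of a Fourier
   series, is obtained as follows: if q is a trigonometric polynomial with values
   in [0, 1], then so is (1 - q^n)^(2^n), and these converge to the indicator of
   {q < 1/2} off {q = 1/2}.  Thus a function all of whose coefficients vanish has
   zero integral on every small interval, hence is zero by Lebesgue
   differentiation. *)
Require Import Defs.
From HB Require Import structures.
From mathcomp Require Import all_boot all_order all_algebra.
From mathcomp Require Import finmap complex.
From mathcomp Require Import all_classical all_reals all_analysis.
From mathcomp Require Import summability measurable_realfun.
From mathcomp Require Import ring lra.

Set Implicit Arguments.
Unset Strict Implicit.
Unset Printing Implicit Defensive.

Import Order.TTheory GRing.Theory Num.Theory.
Import numFieldNormedType.Exports.

Local Open Scope classical_set_scope.
Local Open Scope ring_scope.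
Local Open Scope complex_scope.

(** * Complex-valued functions *)

Section complex_modulus.
Context {R : realType}.
Implicit Types z w : R[i].

(** The two sums over [m] and [n] have to be separated without losing unconditionality. The outer
    series is not estimated on its own: a finite set of [n] is completed to a finite rectangle on
    which the double series is already close to its sum, the inner errors being made small only
    after the number of [n] is known. The other obstacle is null sets. A bracket is a function
    defined at every point, but its series converges absolutely, with a uniform bound, only almost
    everywhere, and it takes a default value elsewhere. Periodicity nevertheless holds at every
    point, because a shift by the period permutes the terms; measurability holds because the set of
    absolute convergence is measurable; boundedness at every point is restored by truncation.
    Estimates use the squared norm in [\bar R]. The inequality |z + w|^2 <= 2|z|^2 + 2|w|^2 stands
    in for the triangle inequality and AM-GM with a free weight for Cauchy-Schwarz, whence the
    recurring factors 2 and 4. *)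

Lemma conjE z : Num.conj z = Complex (complex.Re z) (- complex.Im z).
Proof. by case: z. Qed.

Lemma cabsE z : cabs z = Num.sqrt (complex.Re z ^+ 2 + complex.Im z ^+ 2).
Proof. by case: z. Qed.

Lemma cabs_ge0 z : 0 <= cabs z.
Proof. by rewrite cabsE sqrtr_ge0. Qed.

Lemma sqr_cabs z : cabs z ^+ 2 = complex.Re z ^+ 2 + complex.Im z ^+ 2.
Proof. by rewrite cabsE sqr_sqrtr// addr_ge0 ?sqr_ge0. Qed.

Lemma norm_cabs z : `|z| = (cabs z)%:C.
Proof. by case: z. Qed.

Lemma cabsM z w : cabs (z * w) = cabs z * cabs w.
Proof. by apply: complexI; rewrite rmorphM/= -!norm_cabs normrM. Qed.

Lemma cabsD z w : cabs (z + w) <= cabs z + cabs w.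
Proof. by rewrite -lecR rmorphD/= -!norm_cabs ler_normD. Qed.

Lemma cabsN z : cabs (- z) = cabs z.
Proof. by apply: complexI; rewrite -!norm_cabs normrN. Qed.

Lemma cabs_conj z : cabs (Num.conj z) = cabs z.
Proof. by rewrite !cabsE conjE /= sqrrN. Qed.

Lemma cabs0 : cabs (0 : R[i]) = 0.
Proof. by apply: complexI; rewrite -norm_cabs normr0. Qed.

Lemma cabs_real (r : R) : cabs r%:C = `|r|.
Proof. by rewrite cabsE /= expr0n addr0 sqrtr_sqr. Qed.

Lemma norm_Re_le z : `|complex.Re z| <= cabs z.
Proof. by rewrite cabsE -sqrtr_sqr ler_wsqrtr// lerDl sqr_ge0. Qed.

Lemma norm_Im_le z : `|complex.Im z| <= cabs z.
Proof. by rewrite cabsE -sqrtr_sqr ler_wsqrtr// lerDr sqr_ge0. Qed.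

Lemma cabs_le z : cabs z <= `|complex.Re z| + `|complex.Im z|.
Proof.
rewrite cabsE -[leRHS]ger0_norm ?addr_ge0// -sqrtr_sqr ler_wsqrtr//.
by rewrite sqrrD !real_normK ?num_real// lerD2r lerDl mulrn_wge0// mulr_ge0.
Qed.

Lemma cabs_sum (I : Type) (r : seq I) (P : pred I) (F : I -> R[i]) :
  cabs (\sum_(i <- r | P i) F i) <= \sum_(i <- r | P i) cabs (F i).
Proof.
elim/big_rec2: _ => [|i x y _ le]; first by rewrite cabs0.
by rewrite (le_trans (cabsD _ _))// lerD2l.
Qed.

Lemma mulconj z : z * Num.conj z = (cabs z ^+ 2)%:C.
Proof.
rewrite sqr_cabs conjE; case: z => x y /=; simpc; congr Complex; ring.
Qed.

Lemma sqr_cabsD z w : cabs (z + w) ^+ 2 <= 2 * cabs z ^+ 2 + 2 * cabs w ^+ 2.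
Proof.
have : cabs (z + w) ^+ 2 <= (cabs z + cabs w) ^+ 2.
  by rewrite lerXn2r ?nnegrE ?addr_ge0 ?cabs_ge0// cabsD.
by have := sqr_ge0 (cabs z - cabs w); nra.
Qed.

Lemma ReD z w : complex.Re (z + w) = complex.Re z + complex.Re w.
Proof. by case: z => ? ?; case: w. Qed.
Lemma ImD z w : complex.Im (z + w) = complex.Im z + complex.Im w.
Proof. by case: z => ? ?; case: w. Qed.
Lemma ReN z : complex.Re (- z) = - complex.Re z.
Proof. by case: z. Qed.
Lemma ImN z : complex.Im (- z) = - complex.Im z.
Proof. by case: z. Qed.
Lemma ReM z w : complex.Re (z * w) =
  complex.Re z * complex.Re w - complex.Im z * complex.Im w.
Proof. by case: z => ? ?; case: w. Qed.
Lemma ImM z w : complex.Im (z * w) =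
  complex.Re z * complex.Im w + complex.Im z * complex.Re w.
Proof. by case: z => ? ?; case: w. Qed.

Lemma Re_sum (I : Type) (r : seq I) (P : pred I) (F : I -> R[i]) :
  complex.Re (\sum_(i <- r | P i) F i) = \sum_(i <- r | P i) complex.Re (F i).
Proof. by apply: (big_morph _ ReD). Qed.

Lemma Im_sum (I : Type) (r : seq I) (P : pred I) (F : I -> R[i]) :
  complex.Im (\sum_(i <- r | P i) F i) = \sum_(i <- r | P i) complex.Im (F i).
Proof. by apply: (big_morph _ ImD). Qed.

Lemma complexP z w : complex.Re z = complex.Re w ->
  complex.Im z = complex.Im w -> z = w.
Proof. by case: z => ? ?; case: w => ? ? /= -> ->. Qed.

End complex_modulus.

Section cmeasurable.
Context {R : realType}.
Implicit Types (f h : R -> R[i]).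

Lemma cmeasurable_cst z : cmeasurable (fun _ : R => z).
Proof. by split; exact: measurable_cst. Qed.

Lemma cmeasurableD f h : cmeasurable f -> cmeasurable h ->
  cmeasurable (fun x => f x + h x).
Proof.
move=> [f1 f2] [h1 h2]; split.
  under eq_fun do rewrite ReD; exact: measurable_funD.
under eq_fun do rewrite ImD; exact: measurable_funD.
Qed.

Lemma cmeasurableM f h : cmeasurable f -> cmeasurable h ->
  cmeasurable (fun x => f x * h x).
Proof.
move=> [f1 f2] [h1 h2]; split.
  under eq_fun do rewrite ReM.
  by apply: measurable_funB; apply: measurable_funM.
under eq_fun do rewrite ImM.
by apply: measurable_funD; apply: measurable_funM.
Qed.

Lemma cmeasurableN f : cmeasurable f -> cmeasurable (fun x => - f x).
Proof.
move=> [f1 f2]; split.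
  by under eq_fun do rewrite ReN; exact: (measurableT_comp (@oppr_measurable R setT) f1).
by under eq_fun do rewrite ImN; exact: (measurableT_comp (@oppr_measurable R setT) f2).
Qed.

Lemma cmeasurableB f h : cmeasurable f -> cmeasurable h ->
  cmeasurable (fun x => f x - h x).
Proof. by move=> mf mh; apply: cmeasurableD => //; exact: cmeasurableN. Qed.

Lemma cmeasurable_conj f : cmeasurable f -> cmeasurable (fun x => Num.conj (f x)).
Proof.
move=> [f1 f2]; split; under eq_fun do rewrite conjE; first exact: f1.
exact: (measurableT_comp (@oppr_measurable R setT) f2).
Qed.

Lemma cmeasurable_sum (I : Type) (r : seq I) (F : I -> R -> R[i]) :
  (forall i, cmeasurable (F i)) -> cmeasurable (fun x => \sum_(i <- r) F i x).
Proof.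
move=> mF; elim: r => [|i r IH].
  by under eq_fun do rewrite big_nil; exact: cmeasurable_cst.
by under eq_fun do rewrite big_cons; exact: cmeasurableD.
Qed.

Lemma cmeasurable_real (u : R -> R) : measurable_fun setT u ->
  cmeasurable (fun x => (u x)%:C).
Proof. by move=> mu; split => //=; exact: measurable_cst. Qed.

Lemma cmeasurable_translation c f : cmeasurable f -> cmeasurable (translation c f).
Proof.
move=> [f1 f2]; have mt : measurable_fun [set: R] (fun x : R => x - c).
  exact: measurable_funB.
by split; [apply: (measurableT_comp f1)|apply: (measurableT_comp f2)].
Qed.

Lemma measurable_cabs f : cmeasurable f ->
  measurable_fun setT (fun x => cabs (f x)).
Proof.
move=> [f1 f2]; under eq_fun do rewrite cabsE.
have mS : measurable_fun [set: R]
    (fun x => complex.Re (f x) ^+ 2 + complex.Im (f x) ^+ 2).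
  by apply: measurable_funD; apply: measurable_funX.
exact: (measurableT_comp (continuous_measurable_fun (@sqrt_continuous R)) mS).
Qed.

Lemma measurable_sqr_cabs f : cmeasurable f ->
  measurable_fun setT (fun x => (cabs (f x) ^+ 2)%:E).
Proof.
by move=> mf; apply/measurable_EFinP; apply: measurable_funX; exact: measurable_cabs.
Qed.

End cmeasurable.

(** * The space of square-integrable functions *)

Section L2_space.
Context {R : realType}.
Implicit Types (f h u v : R -> R[i]) (z : R[i]).
Local Notation mu := (@lebesgue_measure R).

(** Taken in [\bar R], it makes sense before square integrability is known, and it avoids square
    roots in the estimates. *)
Definition sqnorm f : \bar R := (\int[mu]_x (cabs (f x) ^+ 2)%:E)%E.

Lemma sqnorm_ge0 f : (0 <= sqnorm f)%E.
Proof. by apply: integral_ge0 => x _; rewrite lee_fin sqr_ge0. Qed.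

Lemma L2normE f : L2norm f = (sqnorm f `^ 2^-1)%E.
Proof.
rewrite /L2norm unlock /sqnorm; congr (_ `^ _)%E.
apply: eq_integral => x _.
rewrite gee0_abs ?lee_fin ?cabs_ge0// poweR_EFin.
by rewrite powR_mulrn ?cabs_ge0.
Qed.

Lemma L2norm_sqr f : (L2norm f ^+ 2 = sqnorm f)%E.
Proof.
rewrite L2normE poweR12_sqrt ?sqnorm_ge0//; have := sqnorm_ge0 f.
case: (sqnorm f) => [r| |]//= r0.
by rewrite -EFinM -expr2 sqr_sqrtr.
Qed.

Lemma L2P f : L2 f <-> cmeasurable f /\ (sqnorm f < +oo)%E.
Proof.
rewrite /L2 L2normE; split=> -[mf h]; split=> //.
  by apply: lty_poweRy h; rewrite invr_eq0.
exact: poweR_lty.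
Qed.

Lemma L2norm_le f e : 0 <= e ->
  (L2norm f <= e%:E)%E = (sqnorm f <= (e ^+ 2)%:E)%E.
Proof.
move=> e0; rewrite -L2norm_sqr; have := poweR_ge0 (sqnorm f) 2^-1.
rewrite -L2normE; case: (L2norm f) => [r| |]//=.
rewrite lee_fin => r0; rewrite -EFinM -expr2 !lee_fin.
by rewrite ler_pXn2r.
Qed.

Lemma le_sqnorm f h : cmeasurable f -> cmeasurable h ->
  (forall x, cabs (f x) <= cabs (h x)) -> (sqnorm f <= sqnorm h)%E.
Proof.
move=> mf mh fh; apply: ge0_le_integral => //.
- by move=> x _; rewrite lee_fin sqr_ge0.
- exact: measurable_sqr_cabs.
- exact: measurable_sqr_cabs.
- by move=> x _; rewrite lee_fin lerXn2r ?nnegrE ?cabs_ge0.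
Qed.

Lemma eq_sqnorm f h : f =1 h -> sqnorm f = sqnorm h.
Proof. by move=> fh; apply: eq_integral => x _; rewrite fh. Qed.

Lemma sqnormZ z f : cmeasurable f ->
  sqnorm (fun x => z * f x) = ((cabs z ^+ 2)%:E * sqnorm f)%E.
Proof.
move=> mf; rewrite -ge0_integralZl//.
- by apply: eq_integral => x _; rewrite cabsM exprMn EFinM.
- exact: measurable_sqr_cabs.
- by move=> x _; rewrite lee_fin sqr_ge0.
- by rewrite lee_fin sqr_ge0.
Qed.

Lemma sqnormN f : sqnorm (fun x => - f x) = sqnorm f.
Proof. by apply: eq_integral => x _; rewrite cabsN. Qed.

Lemma sqnormD f h : cmeasurable f -> cmeasurable h ->
  (sqnorm (fun x => f x + h x)%R <= 2%:E * sqnorm f + 2%:E * sqnorm h)%E.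
Proof.
move=> mf mh.
rewrite -!ge0_integralZl//; try exact: measurable_sqr_cabs;
  try by move=> x _; rewrite lee_fin sqr_ge0.
rewrite -ge0_integralD//; first last.
- by apply: measurable_funeM; exact: measurable_sqr_cabs.
- by move=> x _; rewrite -EFinM lee_fin mulr_ge0// sqr_ge0.
- by apply: measurable_funeM; exact: measurable_sqr_cabs.
- by move=> x _; rewrite -EFinM lee_fin mulr_ge0// sqr_ge0.
apply: ge0_le_integral => //.
- by move=> x _; rewrite lee_fin sqr_ge0.
- by apply: measurable_sqr_cabs; exact: cmeasurableD.
- by apply: emeasurable_funD; apply: measurable_funeM; exact: measurable_sqr_cabs.
- by move=> x _; rewrite -!EFinM -EFinD lee_fin sqr_cabsD.
Qed.

Lemma sqnormB f h : cmeasurable f -> cmeasurable h ->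
  (sqnorm (fun x => f x - h x)%R <= 2%:E * sqnorm f + 2%:E * sqnorm h)%E.
Proof.
by move=> mf mh; rewrite -(sqnormN h); apply: sqnormD => //; exact: cmeasurableN.
Qed.

Lemma L2_cmeas f : L2 f -> cmeasurable f. Proof. by case. Qed.

Lemma L2D f h : L2 f -> L2 h -> L2 (fun x => f x + h x).
Proof.
move=> /L2P[mf qf] /L2P[mh qh]; apply/L2P; split; first exact: cmeasurableD.
apply: le_lt_trans (sqnormD mf mh) _.
by rewrite lte_add_pinfty// lte_mul_pinfty.
Qed.

Lemma L2Z z f : L2 f -> L2 (fun x => z * f x).
Proof.
move=> /L2P[mf qf]; apply/L2P; split.
  by apply: cmeasurableM => //; exact: cmeasurable_cst.
by rewrite sqnormZ// lte_mul_pinfty// lee_fin sqr_ge0.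
Qed.

(** The working form of unconditional convergence: an epsilon over finite sets, stated for the
    squared norm. *)
Lemma L2_sumP (I : choiceType) (u : I -> R -> R[i]) s :
  L2_sum u s <-> [/\ forall i, L2 (u i), L2 s & forall e : R, 0 < e ->
    exists A0 : {fset I}, forall A : {fset I}, (A0 `<=` A)%fset ->
    (sqnorm (fun x => \sum_(i <- A) u i x - s x)%R <= e%:E)%E].
Proof.
split=> -[Lu Ls us]; split => //.
  move=> e e0; have se0 : 0 < Num.sqrt e by rewrite sqrtr_gt0.
  have : nbhs 0%E [set y : \bar R | (y <= (Num.sqrt e)%:E)%E].
    apply/nbhs_EFin/nbhs_ballP; exists (Num.sqrt e) => //= y.
    rewrite /ball/= sub0r normrN lee_fin => /ltW; apply: le_trans.
    exact: ler_norm.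
  move=> /us [A0 _ A0P]; exists A0 => A /A0P /=.
  rewrite L2norm_le ?sqrtr_ge0// (sqr_sqrtr (ltW e0)).
  rewrite (@eq_sqnorm _ (fun x => \sum_(i <- A) u i x - s x))// => x.
  by rewrite /partial_sum big_seq_fsetE.
move=> P /= /nbhs_EFin /nbhs_ballP [e /= e0 eP].
(* Half of [e], since the bound obtained is non-strict while balls are open. *)
have e20 : 0 < e / 2 by rewrite divr_gt0.
have [A0 A0P] := us _ (exprn_gt0 2 e20).
exists A0 => // A /A0P; rewrite -(L2norm_le _ (ltW e20)) => h /=.
rewrite [X in P (L2norm X)](_ : _ = (fun x => \sum_(i <- A) u i x - s x)); last first.
  by apply/funext => x; rewrite /partial_sum big_seq_fsetE.
have := poweR_ge0 (sqnorm (fun x => \sum_(i <- A) u i x - s x)) 2^-1.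
rewrite -L2normE; move: h; case: (L2norm _) => [r| |]//; rewrite !lee_fin => h r0.
apply: eP; rewrite /ball /= sub0r normrN ger0_norm//.
by rewrite (le_lt_trans h)// ltr_pdivrMr// ltr_pMr// ltr1n.
Qed.

Lemma L2N f : L2 f -> L2 (fun x => - f x).
Proof.
move=> /L2P[mf qf]; apply/L2P; split; first exact: cmeasurableN.
by rewrite sqnormN.
Qed.

Lemma L2B f h : L2 f -> L2 h -> L2 (fun x => f x - h x).
Proof. by move=> Lf Lh; apply: L2D => //; exact: L2N. Qed.

Lemma L20 : L2 (fun _ : R => 0 : R[i]).
Proof.
apply/L2P; split; first exact: cmeasurable_cst.
by rewrite /sqnorm; under eq_integral do rewrite cabs0 expr0n/=; rewrite integral0.
Qed.

Lemma L2_sum_seq (I : Type) (r : seq I) (F : I -> R -> R[i]) :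
  (forall i, L2 (F i)) -> L2 (fun x => \sum_(i <- r) F i x).
Proof.
move=> LF; elim: r => [|i r IH].
  by under eq_fun do rewrite big_nil; exact: L20.
by under eq_fun do rewrite big_cons; exact: L2D.
Qed.

Lemma le_L2 f h : cmeasurable f -> L2 h -> (forall x, cabs (f x) <= cabs (h x)) ->
  L2 f.
Proof.
move=> mf /L2P[mh qh] fh; apply/L2P; split => //.
exact: le_lt_trans (le_sqnorm mf mh fh) qh.
Qed.

Lemma sqnorm_fin f : L2 f -> sqnorm f \is a fin_num.
Proof. by move=> /L2P[_ qf]; rewrite ge0_fin_numE// sqnorm_ge0. Qed.

(** Each use of [sqnormD] costs a factor 2, and 2 + 2 * 4^r <= 4^(r+1). The exponential constant is
    harmless because [e] is chosen after the number of terms. *)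
Lemma sqnorm_sum_le (I : choiceType) (r : seq I) (F : I -> R -> R[i]) (e : R) :
  0 <= e ->
  (forall i, cmeasurable (F i)) -> {in r, forall i, sqnorm (F i) <= e%:E}%E ->
  (sqnorm (fun x => \sum_(i <- r) F i x)%R <= (4 ^+ size r * e)%:E)%E.
Proof.
move=> e0 mF; elim: r => [|i r IH] Fe.
  rewrite /sqnorm; under eq_integral do rewrite big_nil cabs0 expr0n/=.
  by rewrite integral0 lee_fin expr0 mul1r.
under eq_sqnorm do rewrite big_cons.
apply: le_trans (sqnormD _ _) _ => //; first exact: cmeasurable_sum.
have Fi := Fe i (mem_head _ _).
have {}IH := IH (fun j jr => Fe j (mem_behead (s := i :: r) jr)).
apply: (@le_trans _ _ (2%:E * e%:E + 2%:E * (4 ^+ size r * e)%:E)%E).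
  by apply: leeD; rewrite lee_pmul2l// lte_fin.
rewrite -!EFinM -EFinD lee_fin /= exprS.
have : 1 <= 4 ^+ size r :> R by rewrite exprn_ege1// ler1n.
by nra.
Qed.

Lemma integrable_mulr k (u : R -> R) : mu.-integrable setT (EFin \o u) ->
  mu.-integrable setT (EFin \o (fun x => k * u x)).
Proof. by move=> iu; exact: (integrableZl measurableT k iu). Qed.

Lemma integrable_addr (u v : R -> R) : mu.-integrable setT (EFin \o u) ->
  mu.-integrable setT (EFin \o v) ->
  mu.-integrable setT (EFin \o (fun x => u x + v x)).
Proof. by move=> iu iv; exact: (integrableD measurableT iu iv). Qed.

Definition cintegrable f :=
  mu.-integrable setT (EFin \o (fun x => complex.Re (f x))) /\
  mu.-integrable setT (EFin \o (fun x => complex.Im (f x))).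

Lemma le_cintegrable f (k : R -> R) : cmeasurable f ->
  mu.-integrable setT (EFin \o k) -> (forall x, cabs (f x) <= k x) ->
  cintegrable f.
Proof.
move=> [f1 f2] ik fk; split.
- apply: le_integrable ik => //; first exact/measurable_EFinP.
  move=> x _ /=; rewrite lee_fin (le_trans (norm_Re_le _))//.
  by rewrite (le_trans (fk x))// ler_norm.
- apply: le_integrable ik => //; first exact/measurable_EFinP.
  move=> x _ /=; rewrite lee_fin (le_trans (norm_Im_le _))//.
  by rewrite (le_trans (fk x))// ler_norm.
Qed.

Lemma cintegralD f h : cintegrable f -> cintegrable h ->
  cintegral (fun x => f x + h x) = cintegral f + cintegral h.
Proof.
move=> [f1 f2] [h1 h2]; apply: complexP; rewrite ?ReD ?ImD /=.
  by under eq_Rintegral do rewrite ReD; rewrite RintegralD.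
by under eq_Rintegral do rewrite ImD; rewrite RintegralD.
Qed.

Lemma cintegralZ z f : cintegrable f ->
  cintegral (fun x => z * f x) = z * cintegral f.
Proof.
move=> [f1 f2]; apply: complexP; rewrite ?ReM ?ImM /=.
  under eq_Rintegral do rewrite ReM.
  by rewrite RintegralB ?RintegralZl//; exact: integrable_mulr.
under eq_Rintegral do rewrite ImM.
by rewrite RintegralD ?RintegralZl//; exact: integrable_mulr.
Qed.

Lemma eq_cintegral f h : f =1 h -> cintegral f = cintegral h.
Proof. by move=> fh; congr cintegral; apply/funext. Qed.

Lemma cintegral_conj f : cintegrable f ->
  cintegral (fun x => Num.conj (f x)) = Num.conj (cintegral f).
Proof.
move=> [f1 f2]; apply: complexP; rewrite conjE /=.
  by apply: eq_Rintegral => x _; rewrite conjE.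
under eq_Rintegral do rewrite conjE /= -mulN1r.
by rewrite RintegralZl// mulN1r.
Qed.

Lemma L2_integrable_sqr f : L2 f ->
  mu.-integrable setT (EFin \o (fun x => cabs (f x) ^+ 2)).
Proof.
move=> /L2P[mf qf]; apply/integrableP; split; first exact: measurable_sqr_cabs.
apply: le_lt_trans qf; rewrite /sqnorm le_eqVlt; apply/orP; left; apply/eqP.
by apply: eq_integral => x _ /=; rewrite ger0_norm// sqr_ge0.
Qed.

(** AM-GM with a free weight [t]; choosing [t] afterwards does the work of the Cauchy-Schwarz
    inequality. *)
Lemma cabs_mulconj_le (t : R) z w : 0 < t ->
  cabs (z * Num.conj w) <= t * cabs z ^+ 2 + t^-1 * cabs w ^+ 2.
Proof.
move=> t0; rewrite cabsM cabs_conj.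
have := sqr_ge0 (t * cabs z - cabs w); have := cabs_ge0 z; have := cabs_ge0 w.
move: (cabs z) (cabs w) => x y y0 x0 h.
rewrite -(ler_pM2l t0) mulrDr [X in _ + X]mulrA divff ?gt_eqF// mul1r.
by have := mulr_ge0 x0 y0; nra.
Qed.

Lemma cintegrable_mulconj f h : L2 f -> L2 h ->
  cintegrable (fun x => f x * Num.conj (h x)).
Proof.
move=> Lf Lh.
apply: (@le_cintegrable _ (fun x => cabs (f x) ^+ 2 + cabs (h x) ^+ 2)).
- by apply: cmeasurableM; [exact: L2_cmeas|apply: cmeasurable_conj; exact: L2_cmeas].
- by apply: integrable_addr => //; exact: L2_integrable_sqr.
- move=> x; have := @cabs_mulconj_le 1 (f x) (h x) ltr01.
  by rewrite invr1 !mul1r.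
Qed.

Lemma L2innerDl f u h : L2 f -> L2 u -> L2 h ->
  L2inner (fun x => f x + u x) h = L2inner f h + L2inner u h.
Proof.
move=> Lf Lu Lh; rewrite -cintegralD; try exact: cintegrable_mulconj.
by apply: eq_cintegral => x; rewrite mulrDl.
Qed.

Lemma L2innerZl z f h : L2 f -> L2 h ->
  L2inner (fun x => z * f x) h = z * L2inner f h.
Proof.
move=> Lf Lh; rewrite -cintegralZ; last exact: cintegrable_mulconj.
by apply: eq_cintegral => x; rewrite mulrA.
Qed.

Lemma L2innerC f h : L2 f -> L2 h -> L2inner f h = Num.conj (L2inner h f).
Proof.
move=> Lf Lh; rewrite -cintegral_conj; last exact: cintegrable_mulconj.
by apply: eq_cintegral => x; rewrite rmorphM /= conjCK mulrC.
Qed.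

Lemma L2inner_suml (I : Type) (r : seq I) (c : I -> R[i]) (F : I -> R -> R[i]) h :
  (forall i, L2 (F i)) -> L2 h ->
  L2inner (fun x => \sum_(i <- r) c i * F i x) h =
  \sum_(i <- r) c i * L2inner (F i) h.
Proof.
move=> LF Lh; elim: r => [|i r IH].
  rewrite big_nil (_ : L2inner _ _ = L2inner (fun x => 0 * 0) h).
    by rewrite L2innerZl ?mul0r//; exact: L20.
  by congr L2inner; apply/funext => x; rewrite big_nil mul0r.
rewrite big_cons -IH -L2innerZl// -L2innerDl//.
- by apply: eq_cintegral => x; rewrite big_cons.
- exact: L2Z.
- by apply: L2_sum_seq => j; exact: L2Z.
Qed.

Lemma L2innerff f : L2 f -> L2inner f f = (fine (sqnorm f))%:C.
Proof.
move=> Lf; apply: complexP => /=.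
  by apply: eq_Rintegral => x _; rewrite mulconj.
under eq_Rintegral do rewrite mulconj /=.
by rewrite Rintegral_cst// mul0r.
Qed.

(** The weighted substitute for Cauchy-Schwarz. The factor 2 comes from bounding the real and
    imaginary parts separately. *)
Lemma cabs_L2inner_le (t : R) f h : 0 < t -> L2 f -> L2 h ->
  cabs (L2inner f h) <= 2 * (t * fine (sqnorm f) + t^-1 * fine (sqnorm h)).
Proof.
move=> t0 Lf Lh; have [i1 i2] := cintegrable_mulconj Lf Lh.
have fi := L2_integrable_sqr Lf; have hi := L2_integrable_sqr Lh.
have tfi : mu.-integrable setT (EFin \o (fun x => t * cabs (f x) ^+ 2)).
  exact: integrable_mulr.
have thi : mu.-integrable setT (EFin \o (fun x => t^-1 * cabs (h x) ^+ 2)).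
  exact: integrable_mulr.
have ti : mu.-integrable setT
    (EFin \o (fun x => t * cabs (f x) ^+ 2 + t^-1 * cabs (h x) ^+ 2)).
  exact: integrable_addr.
have E : Rintegral mu setT (fun x => t * cabs (f x) ^+ 2 + t^-1 * cabs (h x) ^+ 2)
    = t * fine (sqnorm f) + t^-1 * fine (sqnorm h).
  by rewrite RintegralD// !RintegralZl.
rewrite mulr_natl mulr2n; apply: le_trans (cabs_le _) _; rewrite -!E; apply: lerD.
- apply: le_trans (le_normr_Rintegral _ _) _ => //.
  apply: le_Rintegral => //; first exact: integrable_norm.
  by move=> x _; rewrite (le_trans (norm_Re_le _))// cabs_mulconj_le.
- apply: le_trans (le_normr_Rintegral _ _) _ => //.
  apply: le_Rintegral => //; first exact: integrable_norm.
  by move=> x _; rewrite (le_trans (norm_Im_le _))// cabs_mulconj_le.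
Qed.

End L2_space.

(** * Completeness of the space of square-integrable functions *)

Section Riesz_Fischer.
Context {R : realType}.
Local Notation mu := (@lebesgue_measure R).

Lemma ae_imp (P Q : R -> Prop) : {ae mu, forall x, P x} ->
  (forall x, P x -> Q x) -> {ae mu, forall x, Q x}.
Proof. by move=> aeP PQ; apply: negligibleS aeP => x /= nQ /PQ. Qed.

Lemma ae_and (P Q : R -> Prop) : {ae mu, forall x, P x} ->
  {ae mu, forall x, Q x} -> {ae mu, forall x, P x /\ Q x}.
Proof.
move=> aeP aeQ; apply: negligibleS (negligibleU aeP aeQ) => x /= /not_andP[?|?].
  by left.
by right.
Qed.

Lemma ae_eq_sqnorm (f h : R -> R[i]) : cmeasurable f -> cmeasurable h ->
  {ae mu, forall x, f x = h x} -> sqnorm f = sqnorm h.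
Proof.
move=> mf mh fh; apply: ge0_ae_eq_integral => //.
- exact: measurable_sqr_cabs.
- exact: measurable_sqr_cabs.
- by move=> x _; rewrite lee_fin sqr_ge0.
- by move=> x _; rewrite lee_fin sqr_ge0.
- by apply: (ae_imp fh) => x fx _; rewrite fx.
Qed.

Lemma cvgn_geometric_increments (u : R^nat) (C : R) :
  (forall k, `|u k.+1 - u k| <= C * 2^-1 ^+ k) -> cvgn u.
Proof.
move=> uC; have st : cvgn (series (telescope u)).
  apply: normed_cvg; apply: (@series_le_cvg _ _ (geometric C 2^-1)) => //=.
  - by move=> n; rewrite (le_trans _ (uC n)).
  - by apply: is_cvg_geometric_series; rewrite ger0_norm// invf_lt1// ltr1n.
have -> : u = (cst (u 0%N) \+ series (telescope u)).
  by apply/funext => n; rewrite (eq_sum_telescope u n).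
exact: is_cvgD (is_cvg_cst _) st.
Qed.

Lemma cvg_sqr_cabsB (u : nat -> R[i]) (w z : R[i]) :
  (fun j => complex.Re (u j)) @ \oo --> complex.Re z ->
  (fun j => complex.Im (u j)) @ \oo --> complex.Im z ->
  (fun j => cabs (w - u j) ^+ 2) @ \oo --> cabs (w - z) ^+ 2.
Proof.
move=> c1 c2; rewrite sqr_cabs !ReD !ImD !ReN !ImN !expr2.
under eq_fun do rewrite sqr_cabs !ReD !ImD !ReN !ImN !expr2.
by apply: cvgD; apply: cvgM; apply: cvgB => //; exact: cvg_cst.
Qed.

Lemma limn_einf_le (u : (\bar R)^nat) (e : \bar R) :
  (forall n, (u n <= e)%E) -> (limn_einf u <= e)%E.
Proof.
move=> ue; rewrite limn_einf_lim; apply: lime_le; first exact: is_cvg_einfs.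
apply: nearW => n; apply: le_trans (ue n).
by apply: ereal_inf_lbound; exists n => //=.
Qed.

(* The weights [4 ^ k] make the increments [F k.+1 x - F k x] geometrically small
   for almost every [x]; Fatou's lemma then transfers the bound to the limit. *)
Lemma L2_complete (F : nat -> R -> R[i]) : (forall k, L2 (F k)) ->
  (forall k j, (k <= j)%N ->
    sqnorm (fun x => F k x - F j x)%R <= (8^-1 ^+ k)%:E)%E ->
  exists2 s : R -> R[i], L2 s &
    forall k, (sqnorm (fun x => F k x - s x)%R <= (8^-1 ^+ k)%:E)%E.
Proof.
move=> LF FC.
pose d k x := F k x - F k.+1 x.
have md k : cmeasurable (d k) by apply: cmeasurableB; exact: L2_cmeas.
pose G x : \bar R := (\sum_(0 <= k <oo) (4 ^+ k * cabs (d k x) ^+ 2)%:E)%E.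
have mGk k : measurable_fun setT (fun x => (4 ^+ k * cabs (d k x) ^+ 2)%:E).
  apply/measurable_EFinP; apply: measurable_funM => //.
  by apply: measurable_funX; exact: measurable_cabs.
have Gk0 k x : (0 <= (4 ^+ k * cabs (d k x) ^+ 2)%:E)%E.
  by rewrite lee_fin mulr_ge0// ?sqr_ge0// exprn_ge0.
have mG : measurable_fun setT G.
  by apply: ge0_emeasurable_sum => // k x _ _; exact: Gk0.
have G0 x : (0 <= G x)%E by apply: nneseries_ge0 => k _ _; exact: Gk0.
have iG : (\int[mu]_x G x < +oo)%E.
  rewrite integral_nneseries//.
  have sumle : (\sum_(0 <= k <oo) \int[mu]_x (4 ^+ k * cabs (d k x) ^+ 2)%:E <=
      \sum_(0 <= k <oo) (2 / (2 ^ (k + 1))%:R)%:E)%E.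
    apply: lee_nneseries => [k *|k *]; first exact: integral_ge0.
    under eq_integral do rewrite EFinM.
    rewrite ge0_integralZl//; last 2 first.
    - exact: measurable_sqr_cabs.
    - by move=> x _; rewrite lee_fin sqr_ge0.
    (* The product 4^k * 8^-k is 2^-k, so the integrals of the terms of [G] are dominated by a
       geometric series of sum 2. *)
    apply: (@le_trans _ _ ((4 ^+ k)%:E * (8^-1 ^+ k)%:E)%E).
      by apply: lee_wpmul2l; [rewrite lee_fin exprn_ge0|exact: FC].
    rewrite -EFinM lee_fin -exprMn addn1 expnS natrM natrX invfM mulrA divff// mul1r.
    by rewrite -exprVn; apply: lerXn2r; rewrite ?nnegrE//; lra.
  apply: le_lt_trans sumle _.
  have cg := @cvg_geometric_eseries_half R 2 0.
  rewrite (cvg_lim _ cg)//.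
  by rewrite ltry.
pose E := [set x | (G x < +oo)%E].
have mE : measurable E.
  by rewrite -[E]setTI; apply: emeasurable_fun_infty_o.
have aeE : {ae mu, forall x, x \in E}.
  have : mu.-integrable setT G.
    apply/integrableP; split => //.
    by under eq_integral do rewrite gee0_abs//.
  move=> /integrable_ae => /(_ measurableT); apply: filterS => x /(_ I) fG.
  by rewrite inE /E /= ltey_eq fG.
(* Multiplying by the indicator of [E] makes the sequence converge at every point, so its limit is
   measurable; nothing changes almost everywhere. *)
pose FE k x := (\1_E x)%:C * F k x.
have mFE k : cmeasurable (FE k).
  apply: cmeasurableM; last exact: L2_cmeas.
  by apply: cmeasurable_real; exact: measurable_indic.
(* One term of the weighted series is at most [G x]; its square root gives increments of ratio
   1/2. *)
have incr k x : cabs (FE k.+1 x - FE k x) <=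
    Num.sqrt (fine (if x \in E then G x else 0%E)) * 2^-1 ^+ k.
  rewrite /FE -mulrBr cabsM cabs_real indicE.
  case: ifPn => xE /=; last first.
    by rewrite normr0 mul0r mulr_ge0// ?sqrtr_ge0// exprn_ge0.
  rewrite normr1 mul1r -cabsN opprB -/(d k x).
  have fG : G x \is a fin_num by rewrite ge0_fin_numE//; move: xE; rewrite inE.
  have : ((4 ^+ k * cabs (d k x) ^+ 2)%:E <= G x)%E.
    apply: le_trans (nneseries_lim_ge k.+1 _) => //.
    rewrite big_nat_recr//= leeDr//.
    by apply: sume_ge0 => j _.
  rewrite -{1}(fineK fG) lee_fin => h.
  have h2 : (cabs (d k x)) ^+ 2 <= (Num.sqrt (fine (G x)) * 2^-1 ^+ k) ^+ 2.
    rewrite exprMn sqr_sqrtr ?fine_ge0// exprAC exprVn.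
    rewrite (_ : 2 ^+ 2 = 4 :> R); last by rewrite -natrX.
    by rewrite exprVn ler_pdivlMr ?exprn_gt0// mulrC.
  by move: h2; rewrite ler_pXn2r ?nnegrE ?cabs_ge0 ?mulr_ge0 ?sqrtr_ge0 ?exprn_ge0.
have cRe x : cvgn (fun k => complex.Re (FE k x)).
  apply: cvgn_geometric_increments => k; apply: le_trans (incr k x).
  by rewrite -ReN -ReD norm_Re_le.
have cIm x : cvgn (fun k => complex.Im (FE k x)).
  apply: cvgn_geometric_increments => k; apply: le_trans (incr k x).
  by rewrite -ImN -ImD norm_Im_le.
pose s x := Complex (limn (fun k => complex.Re (FE k x)))
                    (limn (fun k => complex.Im (FE k x))).
have ms : cmeasurable s.
  split.
    apply: (@measurable_fun_cvg _ _ _ _ (fun k x => complex.Re (FE k x))).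
      by move=> k; case: (mFE k).
    by move=> x _ /=; exact: cRe.
  apply: (@measurable_fun_cvg _ _ _ _ (fun k x => complex.Im (FE k x))).
    by move=> k; case: (mFE k).
  by move=> x _ /=; exact: cIm.
have Fs k : (sqnorm (fun x => F k x - s x)%R <= (8^-1 ^+ k)%:E)%E.
  have mFk := L2_cmeas (LF k).
  (* The shift to [j + k] keeps the second index at least [k], so the Cauchy bound [FC] applies for
     every [j] before Fatou's lemma is used. *)
  pose f j x := ((cabs (F k x - FE (j + k)%N x)) ^+ 2)%:E.
  have -> : sqnorm (fun x => F k x - s x) = (\int[mu]_x limn_einf (f ^~ x))%E.
    apply: eq_integral => x _.
    have fx : f ^~ x @ \oo --> (cabs (F k x - s x) ^+ 2)%:E.
      rewrite /f; apply: cvg_EFin; first exact: nearW.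
      have c1 : (fun j => complex.Re (FE (j + k)%N x)) @ \oo --> complex.Re (s x).
        by rewrite (cvg_shiftn k (fun j => complex.Re (FE j x)) _); exact: cRe.
      have c2 : (fun j => complex.Im (FE (j + k)%N x)) @ \oo --> complex.Im (s x).
        by rewrite (cvg_shiftn k (fun j => complex.Im (FE j x)) _); exact: cIm.
      exact: cvg_sqr_cabsB.
    by rewrite is_cvg_limn_einfE; [rewrite (cvg_lim _ fx)|apply/cvg_ex; eexists; exact: fx].
  apply: le_trans (fatou _ _ _ _) _ => //.
  - by move=> j; apply: measurable_sqr_cabs; exact: cmeasurableB.
  - by move=> j x _; rewrite lee_fin sqr_ge0.
  apply: limn_einf_le => j.
  rewrite -[leLHS]/(sqnorm (fun x => F k x - FE (j + k)%N x)).
  rewrite (@ae_eq_sqnorm _ (fun x => F k x - F (j + k)%N x)).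
  - by apply: FC; rewrite leq_addl.
  - exact: cmeasurableB.
  - by apply: cmeasurableB => //; exact: L2_cmeas.
  - by apply: (ae_imp aeE) => x xE; rewrite /FE indicE xE mul1r.
exists s => //; apply/L2P; split => //.
have -> : sqnorm s = sqnorm (fun x => F 0%N x - (F 0%N x - s x)).
  by apply: eq_sqnorm => x; rewrite opprB addrC subrK.
have /L2P[mF0 F0oo] := LF 0%N.
apply: le_lt_trans (sqnormB mF0 (cmeasurableB mF0 ms)) _.
rewrite lte_add_pinfty// lte_mul_pinfty//.
by apply: le_lt_trans (Fs 0%N) _; rewrite ltry.
Qed.

End Riesz_Fischer.

(** * Bessel families *)

Section Bessel_families.
Context {R : realType}.
Local Notation mu := (@lebesgue_measure R).

Lemma sum_fsetD (I : choiceType) (V : nmodType) (u : I -> V) (A0 A : {fset I}) :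
  (A0 `<=` A)%fset ->
  \sum_(i <- A) u i = \sum_(i <- A0) u i + \sum_(i <- (A `\` A0)%fset) u i.
Proof.
move=> /fsubsetP AA; rewrite (big_fsetID _ (mem A0)) /=; congr (_ + _).
  apply: eq_fbigl => i; rewrite !inE /=.
  by apply/andP/idP => [[]//|iA]; split => //; exact: AA.
by apply: eq_fbigl => i; rewrite !inE /= andbC.
Qed.

(** A finite set whose sum is within [e] of the supremum leaves at most [e] for all indices outside
    it. *)
Lemma summable_tail (I : choiceType) (d : I -> R) (M : R) :
  (forall i, 0 <= d i) -> (forall A : {fset I}, \sum_(i <- A) d i <= M) ->
  forall e, 0 < e -> exists A0 : {fset I}, forall A : {fset I},
    \sum_(i <- (A `\` A0)%fset) d i <= e.
Proof.
move=> d0 dM e e0.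
pose S := [set \sum_(i <- A) d i | A in [set: {fset I}]].
have hS : has_sup S.
  split; first by exists (\sum_(i <- fset0) d i); exists fset0.
  by exists M => _ [A _ <-].
have [_ [A0 _ <-] A0S] := @sup_adherent _ S e e0 hS.
exists A0 => A.
have : \sum_(i <- (A0 `|` A)%fset) d i <= sup S.
  by apply: sup_upper_bound => //; exists (A0 `|` A)%fset.
rewrite (sum_fsetD _ (fsubsetUl A0 A)) fsetDUl fsetDv fset0U.
by move: A0S; lra.
Qed.

Definition bessel_family (I : choiceType) (phi : I -> R -> R[i]) (B : R) :=
  forall f, L2 f -> forall A : {fset I},
  \sum_(i <- A) cabs (L2inner f (phi i)) ^+ 2 <= B * fine (sqnorm f).

(** Synthesis is adjoint to analysis and so has the same bound: pairing [s] with itself produces the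
    coefficients of [s], to which the Bessel inequality applies again. Half of the resulting bound
    is absorbed on the left. *)
Lemma bessel_synthesis (I : choiceType) (phi : I -> R -> R[i]) (B : R)
    (c : I -> R[i]) (A : {fset I}) : 0 < B -> (forall i, L2 (phi i)) ->
  bessel_family phi B ->
  (sqnorm (fun x => \sum_(i <- A) c i * phi i x)%R
    <= (B * \sum_(i <- A) cabs (c i) ^+ 2)%:E)%E.
Proof.
move=> B0 Lphi bphi; set s := (fun x => _).
have Ls : L2 s by apply: L2_sum_seq => i; exact: L2Z.
rewrite -(fineK (sqnorm_fin Ls)) lee_fin.
set q := fine _; set C := \sum_(i <- A) _.
have qE : q = \sum_(i <- A) complex.Re (c i * Num.conj (L2inner s (phi i))).
  transitivity (complex.Re (L2inner s s)); first by rewrite L2innerff.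
  rewrite /s L2inner_suml// Re_sum; apply: eq_bigr => i _.
  by rewrite [X in _ * X](@L2innerC _ (phi i))//.
have bq := bphi s Ls A; rewrite -/q in bq.
suff : 2 * q <= B * C + q by lra.
(* AM-GM: [2 |c| |d| <= B |c|^2 + |d|^2 / B] *)
apply: (@le_trans _ _ (B * C + B^-1 * \sum_(i <- A) cabs (L2inner s (phi i)) ^+ 2)).
  rewrite {1}qE /C !mulr_sumr -big_split/=; apply: ler_sum => i _.
  have := norm_Re_le (c i * Num.conj (L2inner s (phi i))).
  rewrite cabsM cabs_conj ler_norml => /andP[_].
  have : 0 <= B^-1 * (B * cabs (c i) - cabs (L2inner s (phi i))) ^+ 2.
    by rewrite mulr_ge0 ?sqr_ge0 ?invr_ge0 ?ltW.
  rewrite (_ : B^-1 * _ = B * cabs (c i) ^+ 2 - 2 * (cabs (c i) * cabs (L2inner s (phi i)))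
    + B^-1 * cabs (L2inner s (phi i)) ^+ 2); first by lra.
  by field; rewrite gt_eqF.
by rewrite lerD2l -(ler_pM2l B0) mulrA divff ?gt_eqF// mul1r.
Qed.

(** Completeness is available for sequences, whereas the sum runs over a directed set. A nested
    sequence of finite sets with geometrically small tails is extracted, and its limit is then
    compared with the sum over an arbitrary larger finite set. *)
Lemma bessel_L2_sum (I : choiceType) (phi : I -> R -> R[i]) (B : R) f : 0 < B ->
  (forall i, L2 (phi i)) -> bessel_family phi B -> L2 f ->
  exists s, L2_sum (fun i x => L2inner f (phi i) * phi i x) s.
Proof.
move=> B0 Lphi bphi Lf; pose c i := L2inner f (phi i).
have Lu i : L2 (fun x => c i * phi i x) by exact: L2Z.
have mu_sum A : cmeasurable (fun x => \sum_(i <- A) c i * phi i x).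
  by apply: cmeasurable_sum => i; exact: L2_cmeas.
pose S (A : {fset I}) x := \sum_(i <- A) c i * phi i x.
have tail e : 0 < e -> exists A0 : {fset I}, forall A : {fset I}, (A0 `<=` A)%fset ->
    (sqnorm (fun x => S A x - S A0 x)%R <= e%:E)%E.
  move=> e0.
  have [A0 A0P] := @summable_tail I (fun i => cabs (c i) ^+ 2) _
    (fun i => sqr_ge0 _) (bphi f Lf) _ (divr_gt0 e0 B0).
  exists A0 => A AA.
  rewrite (@eq_sqnorm _ _ (fun x => \sum_(i <- (A `\` A0)%fset) c i * phi i x)); last first.
    by move=> x; rewrite /S (sum_fsetD _ AA) addrAC subrr add0r.
  apply: le_trans (bessel_synthesis c _ B0 Lphi bphi) _.
  by rewrite lee_fin -ler_pdivlMl// mulrC; exact: A0P.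
have tail2 e : 0 < e -> exists A0 : {fset I}, forall A A' : {fset I},
    (A0 `<=` A)%fset -> (A0 `<=` A')%fset ->
    (sqnorm (fun x => S A x - S A' x)%R <= e%:E)%E.
  move=> e0; have e40 : 0 < e / 4 by rewrite divr_gt0.
  have [A0 A0P] := tail _ e40; exists A0 => A A' /A0P h /A0P h'.
  rewrite (@eq_sqnorm _ _ (fun x => (S A x - S A0 x) - (S A' x - S A0 x))); last first.
    by move=> x; rewrite opprB addrA subrK.
  apply: le_trans (sqnormB _ _) _; try exact: cmeasurableB (mu_sum _) (mu_sum _).
  apply: (@le_trans _ _ (2%:E * (e / 4)%:E + 2%:E * (e / 4)%:E)%E).
    by apply: leeD; rewrite lee_pmul2l// lte_fin.
  by rewrite -!EFinM -EFinD lee_fin; lra.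
have [A0 A0P] : exists A0 : nat -> {fset I}, forall k (A A' : {fset I}),
    (A0 k `<=` A)%fset -> (A0 k `<=` A')%fset ->
    (sqnorm (fun x => S A x - S A' x)%R <= (8^-1 ^+ k)%:E)%E.
  have h k : {A0 : {fset I} | forall A A' : {fset I},
      (A0 `<=` A)%fset -> (A0 `<=` A')%fset ->
      (sqnorm (fun x => S A x - S A' x)%R <= (8^-1 ^+ k)%:E)%E}.
    by apply: cid; apply: tail2; rewrite exprn_gt0.
  by exists (fun k => sval (h k)) => k; exact: (svalP (h k)).
(* Cumulative unions make the sets increase with [k] while still containing [A0 k]. *)
pose A1 := fix A1 k := if k is k'.+1 then (A1 k' `|` A0 k)%fset else A0 0%N.
have A01 k : (A0 k `<=` A1 k)%fset by case: k => //= k; rewrite fsubsetUr.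
have A1S k j : (k <= j)%N -> (A1 k `<=` A1 j)%fset.
  elim: j => [|j IH]; first by rewrite leqn0 => /eqP ->.
  rewrite leq_eqVlt => /predU1P[->//|]; rewrite ltnS => /IH kj.
  by rewrite (fsubset_trans kj)//= fsubsetUl.
have [s Ls sP] := @L2_complete R (fun k => S (A1 k))
  (fun k => L2_sum_seq _ Lu)
  (fun k j kj => A0P k _ _ (A01 k) (fsubset_trans (A01 k) (A1S _ _ kj))).
exists s; apply/L2_sumP; split => // e e0.
(* The 4 is 2 + 2, one for each difference in the splitting through [S (A1 k)]. *)
have [k ke] : exists k, 4 * 8^-1 ^+ k <= e :> R.
  have : (fun k : nat => geometric 4 8^-1 k) @ \oo --> (0 : R).
    by apply: cvg_geometric; rewrite ger0_norm// invf_lt1// ltr1n.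
  move=> /cvgr0Pnorm_le /(_ _ e0) [k _ /(_ k (leqnn k))] /= h; exists k.
  by apply: le_trans h; exact: ler_norm.
exists (A1 k) => A kA.
rewrite (@eq_sqnorm _ _ (fun x => (S A x - S (A1 k) x) + (S (A1 k) x - s x))); last first.
  by move=> x; rewrite addrA subrK.
apply: le_trans (sqnormD _ _) _.
- exact: cmeasurableB (mu_sum _) (mu_sum _).
- exact: cmeasurableB (mu_sum _) (L2_cmeas Ls).
apply: (@le_trans _ _ (2%:E * (8^-1 ^+ k)%:E + 2%:E * (8^-1 ^+ k)%:E)%E).
  apply: leeD; rewrite lee_pmul2l// ?lte_fin//.
  by apply: A0P => //; rewrite (fsubset_trans (A01 k)).
by rewrite -!EFinM -EFinD lee_fin; lra.
Qed.

End Bessel_families.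

(** * Unfolding integrals along a lattice *)

Section translation_invariance.
Context {R : realType}.
Local Notation mu := (@lebesgue_measure R).

Lemma measurable_translate (t : R) :
  measurable_fun [set: R] (fun x : R => x - t).
Proof. exact: measurable_funB. Qed.

Lemma lebesgue_measure_translate (t : R) (A : set R) : measurable A ->
  pushforward mu ((fun x : R => x - t) : _ -> measurableTypeR R) A = mu A.
Proof.
move=> mA; apply/esym/lebesgue_measure_unique => //=.
  exact: measurable_translate.
move=> mt _ [[a b]] _ <-.
rewrite /pushforward (_ : _ @^-1` _ = `]a + t, b + t]%classic).
  rewrite /= !lebesgue_measure_itv/= !lte_fin ltrD2r; case: ifPn => // _.
  by rewrite -!EFinB; congr EFin; lra.
apply/seteqP; split => x /=; rewrite !in_itv/=; lra.
Qed.

Lemma ge0_integral_translate (t : R) (D : set R) (f : R -> \bar R) :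
  measurable D -> measurable_fun setT f -> (forall x, 0 <= f x)%E ->
  (\int[mu]_(x in D) f x = \int[mu]_(x in [set x | D (x - t)%R]) f (x - t)%R)%E.
Proof.
move=> mD mf f0.
pose phi : measurableTypeR R -> measurableTypeR R := fun x => x - t.
have mphi : measurable_fun setT phi by exact: measurable_translate.
rewrite -[RHS](@ge0_integral_pushforward _ _ _ _ _ phi mphi mu D f)//.
- by apply: eq_measure_integral => A mA _; exact/esym/lebesgue_measure_translate.
- exact: measurable_funS mf.
Qed.

Lemma integral_translate (t : R) (D : set R) (f : R -> \bar R) :
  measurable D -> measurable_fun setT f ->
  (\int[mu]_(x in D) f x = \int[mu]_(x in [set x | D (x - t)%R]) f (x - t)%R)%E.
Proof.
move=> mD mf; rewrite integralE [RHS]integralE.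
have mp : measurable_fun [set: R] (f^\+)%E by exact: measurable_funepos.
have mn : measurable_fun [set: R] (f^\-)%E by exact: measurable_funeneg.
have p0 x : (0 <= f^\+ x)%E by exact: funepos_ge0.
have n0 x : (0 <= f^\- x)%E by exact: funeneg_ge0.
rewrite (ge0_integral_translate t mD mp p0) (ge0_integral_translate t mD mn n0).
by congr (_ - _)%E; apply: eq_integral => x _; rewrite ?funeposE ?funenegE.
Qed.

Lemma ae_translate (t : R) (P : R -> Prop) : {ae mu, forall x, P x} ->
  {ae mu, forall x, P (x - t)}.
Proof.
move=> [N [mN N0 PN]]; exists ((fun x => x - t) @^-1` N); split.
- by rewrite -[X in measurable X]setTI; exact: measurable_translate.
- by rewrite -N0; exact: lebesgue_measure_translate.
- by move=> x /= nP; apply: PN.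
Qed.

Lemma sqnorm_translation (t : R) f : cmeasurable f ->
  sqnorm (translation t f) = sqnorm f.
Proof.
move=> mf; rewrite /sqnorm [RHS](integral_translate t)//.
exact: measurable_sqr_cabs.
Qed.

Lemma L2_translation (t : R) f : L2 f -> L2 (translation t f).
Proof.
move=> /L2P[mf qf]; apply/L2P; split; first exact: cmeasurable_translation.
by rewrite sqnorm_translation.
Qed.

End translation_invariance.

Section unfolding.
Context {R : realType} (c : R).
Context (c0 : 0 < c).
Local Notation mu := (@lebesgue_measure R).

(* The half-open window is the disjoint union of the translates of [[0, c[] by
   [Posz i] and [Negz i], [i < N]; it is therefore not symmetric around 0. *)
Definition window (N : nat) : set R := `[(1 - N%:R) * c, (1 + N%:R) * c[%classic.

Lemma integral_interval_translate (t : R) (f : R -> \bar R) :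
  measurable_fun setT f ->
  (\int[mu]_(x in `[t, (t + c)%R[) f x = \int[mu]_(x in `[0%R, c[) f (x + t)%R)%E.
Proof.
move=> mf; rewrite (integral_translate (- t))//; congr integral.
  by apply/seteqP; split => x /=; rewrite !in_itv/= opprK; lra.
by apply/funext => x; rewrite opprK.
Qed.

(** Since the translates are by [x - k c], the index [Posz N] adds the cell on the left and [Negz N]
    the cell on the right. *)
Lemma windowS N : window N.+1 =
  (window N `|` `[- N%:R * c, - N%:R * c + c[%classic) `|`
  `[N.+1%:R * c, N.+1%:R * c + c[%classic.
Proof.
have cp := c0; have Nc : 0 <= N%:R * c by rewrite mulr_ge0// ltW.
rewrite /window mulNr -natr1 !mulrBl !mulrDl !mul1r.
apply/seteqP; split => x /=; rewrite !in_itv/=.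
  move=> /andP[h1 h2].
  have [h3|h3] := ltP x (c - N%:R * c).
    by left; right; apply/andP; split; lra.
  have [h4|h4] := ltP x (c + N%:R * c).
    by left; left.
  by right; apply/andP; split; lra.
by move=> [[]|] /andP[h1 h2]; apply/andP; split; lra.
Qed.

Lemma disjoint_windowSl N :
  [disjoint window N & `[- N%:R * c, - N%:R * c + c[%classic].
Proof.
rewrite /window mulNr !mulrBl !mulrDl !mul1r.
by apply/disj_setPS => x [] /=; rewrite !in_itv/= => /andP[h1 h2] /andP[h3 h4]; lra.
Qed.

Lemma disjoint_windowSr N :
  [disjoint window N `|` `[- N%:R * c, - N%:R * c + c[%classic &
    `[N.+1%:R * c, N.+1%:R * c + c[%classic].
Proof.
have cp := c0; have Nc : 0 <= N%:R * c by rewrite mulr_ge0// ltW.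
rewrite /window mulNr -natr1 !mulrBl !mulrDl !mul1r.
by apply/disj_setPS => x [[]] /=; rewrite !in_itv/= => /andP[h1 h2] /andP[h3 h4]; lra.
Qed.

Lemma integral_window (f : R -> \bar R) N : measurable_fun setT f ->
  (\int[mu]_(x in window N) f x =
  \sum_(i < N) (\int[mu]_(x in `[0%R, c[) f (x - (Posz i)%:~R * c)%R +
                \int[mu]_(x in `[0%R, c[) f (x - (Negz i)%:~R * c)%R))%E.
Proof.
move=> mf; have mfD (D : set R) : measurable_fun D f by exact: measurable_funS mf.
elim: N => [|N IH].
  rewrite big_ord0 /window subr0 addr0 set_itv_ge ?integral_set0//.
  by rewrite bnd_simp ltxx.
rewrite big_ord_recr/= -IH windowS.
rewrite integral_setU//; first last.
- exact: disjoint_windowSr.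
- exact: mfD.
- by apply: measurableU; exact: measurable_itv.
rewrite integral_setU//; first last.
- exact: disjoint_windowSl.
- exact: mfD.
  exact: measurable_itv.
rewrite -addeA; congr (_ + (_ + _))%E; rewrite integral_interval_translate//.
- by apply: eq_integral => x _; rewrite mulNr pmulrn.
- by apply: eq_integral => x _; rewrite NegzE mulrNz mulNr opprK -pmulrn.
Qed.

Lemma subset_window : {homo window : n m / (n <= m)%N >-> n `<=` m}.
Proof.
move=> n m nm x; rewrite /window /= !in_itv/= => /andP[h1 h2].
have : n%:R * c <= m%:R * c by rewrite ler_pM2r// ler_nat.
by move=> ?; apply/andP; split; nra.
Qed.

Lemma bigcup_window : \bigcup_N window N = setT.
Proof.
have cp := c0; apply/seteqP; split => // x _.
have [k] : exists k : nat, `|x| < k%:R * c.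
  exists (Num.truncn (`|x| / c)).+1; rewrite -ltr_pdivrMr//.
  by apply: truncnS_gt; rewrite divr_ge0// ltW.
move=> xk; have /andP[h1 h2] : - (k%:R * c) < x < k%:R * c by rewrite -ltr_norml.
exists k.+1 => //.
rewrite /window -natr1 !mulrBl !mulrDl !mul1r /= in_itv/=.
by apply/andP; split; lra.
Qed.

Lemma ge0_integral_window_le (f : R -> \bar R) (K : \bar R) :
  measurable_fun setT f -> (forall x, 0 <= f x)%E ->
  (forall N, \int[mu]_(x in window N) f x <= K)%E -> (\int[mu]_x f x <= K)%E.
Proof.
move=> mf f0 fK; rewrite -bigcup_window.
have mfD (D : set R) : measurable_fun D f by exact: measurable_funS mf.
have h := @ge0_nondecreasing_set_cvg_integral _ (measurableTypeR R) _ window f mu.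
have {}h : (\int[mu]_(x in window i) f x @[i --> \oo] -->
    \int[mu]_(x in \bigcup_i window i) f x)%E.
  apply: h => //.
  - by move=> n m nm; apply/subsetPset; exact: subset_window.
  - by move=> i; exact: measurable_itv.
  - by move=> i; exact: mfD.
rewrite -(cvg_lim _ h)//; apply: lime_le; last exact: nearW.
by apply/cvg_ex; eexists; exact: h.
Qed.

Lemma integral_window_cvg (f : R -> R) : mu.-integrable setT (EFin \o f) ->
  (\int[mu]_(x in window N) (f x)%:E @[N --> \oo] --> \int[mu]_x (f x)%:E)%E.
Proof.
move=> if_; have mf : measurable_fun [set: R] (EFin \o f) by exact: measurable_int if_.
have mfD (D : set R) : measurable_fun D (EFin \o f) by exact: measurable_funS mf.
pose fN N := (EFin \o f) \_ (window N).
under eq_fun do rewrite integral_mkcond.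
have [] := @dominated_convergence _ _ _ mu setT measurableT fN (EFin \o f)
  (abse \o (EFin \o f)).
- by move=> N; apply/(measurable_restrictT _ _).1; [exact: measurable_itv|exact: mfD].
- exact: mf.
- apply: aeW => x _.
  have [N _ xN] : (\bigcup_N window N) x by rewrite bigcup_window.
  apply: cvg_near_cst; exists N => // m /= Nm.
  by rewrite /fN patchE mem_set//; exact: subset_window xN.
- exact: integrable_abse.
- apply: aeW => x N _; rewrite /fN patchE; case: ifPn => // _.
  by rewrite abse0 abse_ge0.
- by [].
Qed.

Lemma integrable_itv_bounded (u : R -> R) (C : R) : measurable_fun setT u ->
  (forall x, `|u x| <= C) -> mu.-integrable `[0%R, c[%classic (EFin \o u).
Proof.
move=> mu_ uC; have mI : measurable_fun `[0, c[%classic (EFin \o u).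
  by apply/measurable_EFinP; exact: measurable_funS mu_.
apply/integrableP; split; first exact: mI.
apply: (@le_lt_trans _ _ (\int[mu]_(x in `[0%R, c[) (cst C%:E) x)%E).
  apply: ge0_le_integral => //.
  - exact: measurableT_comp mI.
  - by move=> x _ /=; rewrite lee_fin.
rewrite integral_cst; last exact: measurable_itv.
by rewrite /= lebesgue_measure_itv/= lte_fin c0 sube0 -EFinM ltry.
Qed.

(** Integrals over [window N] equal integrals over one period of the partial sums. The former
    converge because [K] is integrable, the latter by dominated convergence, the constant [C] being
    integrable over a period; the two limits are compared. *)
Lemma Rintegral_unfold (K L : R -> R) (C : R) :
  mu.-integrable setT (EFin \o K) -> measurable_fun setT L ->
  {ae mu, forall x, `[0%R, c[%classic x -> forall N,
    `|\sum_(i < N) (K (x - (Posz i)%:~R * c) + K (x - (Negz i)%:~R * c))| <= C} ->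
  {ae mu, forall x, `[0%R, c[%classic x ->
    (fun N : nat => \sum_(i < N)
      (K (x - (Posz i)%:~R * c) + K (x - (Negz i)%:~R * c))) @ \oo --> L x} ->
  Rintegral mu setT K = Rintegral mu `[0%R, c[%classic L.
Proof.
move=> iK mL aeC aeL; have mK : measurable_fun [set: R] (EFin \o K) by exact: measurable_int iK.
have mKt (t : R) : measurable_fun setT (fun x : R => K (x - t)).
  apply: (measurableT_comp _ (measurable_translate t)).
  exact/measurable_EFinP.
pose a N x := \sum_(i < N) (K (x - (Posz i)%:~R * c) + K (x - (Negz i)%:~R * c)).
have ma N : measurable_fun setT (a N).
  by apply: measurable_sum => i; apply: measurable_funD.
have iKt (t : R) : mu.-integrable `[0%R, c[%classic (EFin \o (fun x : R => K (x - t))).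
  apply: integrableS (measurableT) _ _ _ => //.
  apply/integrableP; split.
    have mKe : measurable_fun [set: R] (EFin \o (fun x : R => K (x - t))).
      apply/measurable_EFinP; exact: mKt.
    exact: mKe.
  have /integrableP[_] := iK; rewrite (integral_translate t)//.
  exact: measurableT_comp.
have wE N : (\int[mu]_(x in window N) (K x)%:E = \int[mu]_(x in `[0%R, c[) (a N x)%:E)%E.
  rewrite integral_window//.
  under [RHS]eq_integral do rewrite -sumEFin.
  rewrite integral_sum//; last first.
    move=> i; apply: (integrableD _ (iKt _) (iKt _)) => //.
  by apply: eq_bigr => i _; rewrite -integralD//; exact: iKt.
have [] := @dominated_convergence _ _ _ mu `[0%R, c[%classic _
  (fun N => EFin \o a N) (EFin \o L) (EFin \o cst `|C|).
- exact: measurable_itv.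
- by move=> N; apply/measurable_EFinP; exact: measurable_funS (ma N).
- by apply/measurable_EFinP; exact: measurable_funS mL.
- apply: (ae_imp aeL) => x h xI; apply: cvg_EFin; [exact: nearW|exact: h].
- by apply: (@integrable_itv_bounded _ `|C|) => // x; rewrite normr_id.
- by apply: (ae_imp aeC) => x h N xI; rewrite lee_fin (le_trans (h xI N))// ler_norm.
move=> _ _ /= h2; congr fine.
have h1 := integral_window_cvg iK; rewrite (funext wE) in h1.
by rewrite -(cvg_lim _ h1)// -(cvg_lim _ h2).
Qed.

End unfolding.

(** * Fourier series *)

Section exponentials.
Context {R : realType}.
Local Notation mu := (@lebesgue_measure R).

Definition cis (t : R) : R[i] := cos t +i* sin t.

Lemma cisD s t : cis (s + t) = cis s * cis t.
Proof. by rewrite /cis cosD sinD; simpc; congr Complex; rewrite addrC. Qed.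

Lemma cis0 : cis 0 = 1.
Proof. by rewrite /cis cos0 sin0. Qed.

Lemma conj_cis t : Num.conj (cis t) = cis (- t).
Proof. by rewrite conjE /cis cosN sinN. Qed.

Lemma cabs_cis t : cabs (cis t) = 1.
Proof. by rewrite cabsE /= cos2Dsin2 sqrtr1. Qed.

Lemma cis_nat (n : nat) : cis (2 * pi * n%:R) = 1.
Proof.
elim: n => [|n IH]; first by rewrite mulr0 cis0.
rewrite -[n.+1%:R]natr1 mulrDr mulr1 cisD IH mul1r mulr_natl /cis.
by rewrite cos2pi sin2pi.
Qed.

Lemma cis_int (k : int) : cis (2 * pi * k%:~R) = 1.
Proof.
case: k => n; first exact: cis_nat.
by rewrite NegzE mulrNz mulrN -conj_cis -[_%:~R]/(n.+1%:R) cis_nat rmorph1.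
Qed.

(** The character of the modulation by [m * b], bracketed as in [modulation] so that [gabor] reduces
    to it by conversion. *)
Definition expi (b : R) (m : int) (x : R) : R[i] := cis (2 * pi * (m%:~R * b) * x).

Lemma expiD b m k x : expi b (m + k) x = expi b m x * expi b k x.
Proof. by rewrite /expi -cisD; congr cis; rewrite rmorphD/=; ring. Qed.

Lemma expi0 b x : expi b 0 x = 1.
Proof. by rewrite /expi mul0r mulr0 mul0r cis0. Qed.

Lemma conj_expi b m x : Num.conj (expi b m x) = expi b (- m) x.
Proof. by rewrite /expi conj_cis; congr cis; rewrite rmorphN/=; ring. Qed.

Lemma cabs_expi b m x : cabs (expi b m x) = 1.
Proof. exact: cabs_cis. Qed.

Lemma expi_periodic b m (k : int) x : b != 0 ->
  expi b m (x - k%:~R * b^-1) = expi b m x.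
Proof.
move=> b0; rewrite /expi.
have -> : 2 * pi * (m%:~R * b) * (x - k%:~R * b^-1) =
    2 * pi * (m%:~R * b) * x + 2 * pi * (- (m * k))%:~R.
  rewrite rmorphN rmorphM /= mulrBr; congr (_ + _).
  by rewrite mulrN; congr (- _); field.
by rewrite cisD cis_int mulr1.
Qed.

Lemma cmeasurable_expi b m : cmeasurable (expi b m).
Proof.
have ml : measurable_fun [set: R] (fun x => 2 * pi * (m%:~R * b) * x).
  exact: measurable_funM.
split.
- exact: (measurableT_comp (continuous_measurable_fun (@continuous_cos R)) ml).
- exact: (measurableT_comp (continuous_measurable_fun (@continuous_sin R)) ml).
Qed.

Lemma integral_cos_period (a c : R) : a != 0 -> 0 < c -> sin (a * c) = 0 ->
  Rintegral mu `[0%R, c[%classic (fun x => cos (a * x)) = 0.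
Proof.
move=> a0 c0 ac.
have ct : continuous (fun x : R => cos (a * x)).
  move=> x; apply: continuous_comp; last exact: continuous_cos.
  by apply: continuousM; [exact: cst_continuous|exact: cvg_id].
rewrite Rintegral_itv_bndo_bndc; last first.
  apply: (@integrable_itv_bounded _ _ c0 _ 1).
    exact: continuous_measurable_fun.
  by move=> x; exact: cos_max.
have dF (x : R) : is_derive x 1 (fun y => a^-1 * sin (a * y)) (cos (a * x)).
  have H1 : is_derive x 1 (fun y => a * y) a.
    by apply: is_derive_eq; rewrite -[_ *: _]/(_ * _) mulr1.
  apply: is_derive_eq; rewrite -[_ *: _]/(_ * _).
  by field.
have cF : continuous (fun y => a^-1 * sin (a * y)).
  by move=> x; apply/differentiable_continuous/derivable1_diffP; case: (dF x).
rewrite /Rintegral (continuous_FTC2 (F := fun y => a^-1 * sin (a * y)))//.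
- by rewrite ac !mulr0 sin0 mulr0 subee.
- exact: continuous_subspaceT.
- split.
  + by move=> x _; case: (dF x).
  + exact: cvg_at_right_filter (cF 0).
  + exact: cvg_at_left_filter (cF c).
- by move=> x _; rewrite derive1E; case: (dF x) => _ ->.
Qed.

Lemma integral_sin_period (a c : R) : a != 0 -> 0 < c -> cos (a * c) = 1 ->
  Rintegral mu `[0%R, c[%classic (fun x => sin (a * x)) = 0.
Proof.
move=> a0 c0 ac.
have ct : continuous (fun x : R => sin (a * x)).
  move=> x; apply: continuous_comp; last exact: continuous_sin.
  by apply: continuousM; [exact: cst_continuous|exact: cvg_id].
rewrite Rintegral_itv_bndo_bndc; last first.
  apply: (@integrable_itv_bounded _ _ c0 _ 1).
    exact: continuous_measurable_fun.
  by move=> x; exact: sin_max.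
have dF (x : R) : is_derive x 1 (fun y => - a^-1 * cos (a * y)) (sin (a * x)).
  have H1 : is_derive x 1 (fun y => a * y) a.
    by apply: is_derive_eq; rewrite -[_ *: _]/(_ * _) mulr1.
  apply: is_derive_eq; rewrite -[_ *: _]/(_ * _).
  by field.
have cF : continuous (fun y => - a^-1 * cos (a * y)).
  by move=> x; apply/differentiable_continuous/derivable1_diffP; case: (dF x).
rewrite /Rintegral (continuous_FTC2 (F := fun y => - a^-1 * cos (a * y)))//.
- by rewrite ac mulr0 cos0 subee.
- exact: continuous_subspaceT.
- split.
  + by move=> x _; case: (dF x).
  + exact: cvg_at_right_filter (cF 0).
  + exact: cvg_at_left_filter (cF c).
- by move=> x _; rewrite derive1E; case: (dF x) => _ ->.
Qed.

End exponentials.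

(** * Polynomials in q approximating a step at 1/2 *)

Section stone_powers.
Context {R : realType}.

Lemma bernoulli_le (y : R) N : 0 <= y <= 1 -> 1 - N%:R * y <= (1 - y) ^+ N.
Proof.
move=> /andP[y0 y1]; elim: N => [|N IH]; first by rewrite mul0r subr0 expr0.
rewrite exprS -natr1.
have : (1 - y) * (1 - N%:R * y) <= (1 - y) * (1 - y) ^+ N.
  by rewrite ler_wpM2l// subr_ge0.
have : 0 <= N%:R * (y * y) by rewrite !mulr_ge0.
by nra.
Qed.

(** The product does not increase with [N], because (1 - y)(1 + (N+1)y) <= 1 + Ny. *)
Lemma bernoulli_ge (y : R) N : 0 <= y <= 1 ->
  (1 - y) ^+ N * (1 + N%:R * y) <= 1.
Proof.
move=> /andP[y0 y1]; elim: N => [|N IH]; first by rewrite mul0r addr0 expr0 mulr1.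
apply: le_trans IH; rewrite exprS -mulrA mulrCA ler_wpM2l//.
  by rewrite exprn_ge0// subr_ge0.
rewrite -natr1.
have : 0 <= N%:R * (y * y) by rewrite !mulr_ge0.
by nra.
Qed.

(** The exponent [2 ^ n] places the threshold at 1/2: the two Bernoulli inequalities give the lower
    bound 1 - (2q)^n and the upper bound (2q)^-n. The same powers occur in the elementary proof of
    the Stone-Weierstrass theorem. *)
Definition step (q : R) (n : nat) : R := (1 - q ^+ n) ^+ (2 ^ n).

Lemma step_bounds q n : 0 <= q <= 1 -> 0 <= step q n <= 1.
Proof.
move=> /andP[q0 q1]; have qn1 : q ^+ n <= 1 by rewrite exprn_ile1.
by rewrite /step exprn_ge0 ?subr_ge0// exprn_ile1 ?subr_ge0// gerBl exprn_ge0.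
Qed.

Lemma cvg_step_lt q : 0 <= q -> q < 1 / 2 -> step q @ \oo --> (1 : R).
Proof.
move=> q0 q2; have q1 : q <= 1 by lra.
have qn n : 0 <= q ^+ n <= 1 by rewrite exprn_ge0// exprn_ile1.
have h : (fun n : nat => 1 - geometric 1 (2 * q) n) @ \oo --> (1 : R).
  rewrite -[X in _ --> X]subr0; apply: cvgB; first exact: cvg_cst.
  by apply: cvg_geometric; rewrite ger0_norm ?mulr_ge0//; lra.
apply: (@squeeze_cvgr _ _ _ _ (fun n => 1 - geometric 1 (2 * q) n) (cst 1) _ _ 1 h (cvg_cst _)).
apply: nearW => n; rewrite /geometric /= mul1r exprMn -natrX.
apply/andP; split; first exact: bernoulli_le.
by have /andP[] := @step_bounds q n ltac:(by rewrite q0).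
Qed.

Lemma cvg_step_gt q : q <= 1 -> 1 / 2 < q -> step q @ \oo --> (0 : R).
Proof.
move=> q1 q2; have q0 : 0 <= q by lra.
have qn n : 0 <= q ^+ n <= 1 by rewrite exprn_ge0// exprn_ile1.
have h : geometric 1 (2 * q)^-1 @ \oo --> (0 : R).
  apply: cvg_geometric; rewrite ger0_norm ?invr_ge0 ?mulr_ge0//.
  by rewrite invf_lt1//; lra.
apply: (squeeze_cvgr _ (cvg_cst 0) h).
apply: nearW => n; have /andP[s0 _] := @step_bounds q n ltac:(by rewrite q0).
rewrite s0 /geometric /= mul1r exprVn.
have p0 : 0 < (2 * q) ^+ n by rewrite exprn_gt0//; lra.
rewrite -[leRHS]mul1r ler_pdivlMr// exprMn -natrX.
apply: le_trans (bernoulli_ge (2 ^ n)%N (qn n)); rewrite ler_wpM2l//.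
by rewrite lerDr.
Qed.

End stone_powers.

(** * Exponentials on one period and trigonometric bumps *)

Section fourier_series.
Context {R : realType} (b : R).
Context (b0 : 0 < b).
Local Notation mu := (@lebesgue_measure R).
Local Notation I := (`[0%R, b^-1[%classic : set R).

(** Functions on a period are represented by functions on the line that this factor leaves
    unchanged, so that the theory of L^2 of the line serves for Fourier series as well. *)
Definition cell (x : R) : R[i] := (\1_I x)%:C.

Lemma cell_period : 0 < b^-1. Proof. by rewrite invr_gt0. Qed.

Lemma cabs_cell x : cabs (cell x) = \1_I x.
Proof. by rewrite cabs_real ger0_norm// indicE. Qed.

Lemma cabs_cell_le1 x : cabs (cell x) <= 1.
Proof. by rewrite cabs_cell indicE; case: (_ \in _). Qed.

Lemma cell_idem x : cell x * cell x = cell x.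
Proof. by rewrite /cell -rmorphM/= indicE; case: (_ \in _); rewrite ?mulr1 ?mulr0. Qed.

Lemma conj_cell x : Num.conj (cell x) = cell x.
Proof. by rewrite conjE /= oppr0. Qed.

Lemma cmeasurable_cell : cmeasurable cell.
Proof. by apply: cmeasurable_real; apply: measurable_indic; exact: measurable_itv. Qed.

Lemma Rintegral_cell (u : R -> R) :
  Rintegral mu setT (fun x => \1_I x * u x) = Rintegral mu I u.
Proof.
rewrite [RHS]Rintegral_mkcond; apply: eq_Rintegral => x _.
by rewrite patchE indicE; case: (x \in I); rewrite ?mul1r ?mul0r.
Qed.

Lemma sqnorm_cell_bounded (F : R -> R[i]) (C : R) : cmeasurable F -> 0 <= C ->
  (forall x, cabs (F x) <= C) ->
  (sqnorm (fun x => cell x * F x)%R <= (C ^+ 2 * b^-1)%:E)%E.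
Proof.
move=> mF C0 FC.
apply: (@le_trans _ _ (\int[mu]_(x in I) (cst (C ^+ 2)%:E) x)%E).
  rewrite [leRHS]integral_mkcond; apply: ge0_le_integral => //.
  - by move=> x _; rewrite lee_fin sqr_ge0.
  - by apply: measurable_sqr_cabs; apply: cmeasurableM => //; exact: cmeasurable_cell.
  - by apply/(measurable_restrictT _ _).1; [exact: measurable_itv|exact: measurable_cst].
  - move=> x _; rewrite patchE cabsM cabs_cell indicE.
    case: (x \in I) => /=; last by rewrite mul0r expr0n.
    by rewrite mul1r lee_fin lerXn2r ?nnegrE ?cabs_ge0.
rewrite integral_cst; last exact: measurable_itv.
by rewrite /= lebesgue_measure_itv/= lte_fin invr_gt0 b0 sube0 -EFinM.
Qed.

Lemma L2_cell_bounded (F : R -> R[i]) (C : R) : cmeasurable F ->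
  (forall x, cabs (F x) <= C) -> L2 (fun x => cell x * F x).
Proof.
move=> mF FC; have C0 : 0 <= C by apply: le_trans (FC 0); exact: cabs_ge0.
apply/L2P; split; first by apply: cmeasurableM => //; exact: cmeasurable_cell.
by apply: le_lt_trans (sqnorm_cell_bounded mF C0 FC) _; rewrite ltry.
Qed.

Definition expcell (m : int) (x : R) := cell x * expi b m x.

Lemma L2_expcell m : L2 (expcell m).
Proof.
apply: (@L2_cell_bounded _ 1); first exact: cmeasurable_expi.
by move=> x; rewrite cabs_expi.
Qed.

(** The exponentials are not normalised; their common squared norm is the source of the factor 1/b
    in the final formula. *)
Lemma expcell_ortho m k :
  L2inner (expcell m) (expcell k) = if m == k then (b^-1)%:C else 0.
Proof.
have -> : L2inner (expcell m) (expcell k) =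
    cintegral (fun x => cell x * expi b (m - k) x).
  apply: eq_cintegral => x; rewrite /expcell rmorphM/= conj_cell conj_expi expiD.
  by rewrite -[in RHS](cell_idem x); ring.
rewrite /cintegral.
under eq_Rintegral do rewrite ReM /= mul0r subr0.
under [X in _ +i* X]eq_Rintegral do rewrite ImM /= mul0r addr0.
rewrite !Rintegral_cell; have [->|mk] := eqVneq m k.
  under eq_Rintegral do rewrite subrr mul0r mulr0 mul0r cos0.
  under [X in _ +i* X]eq_Rintegral do rewrite subrr mul0r mulr0 mul0r sin0.
  rewrite !Rintegral_cst; try exact: measurable_itv.
  have mI : fine (mu I) = b^-1.
    by rewrite lebesgue_measure_itv/= lte_fin invr_gt0 b0 sube0.
  rewrite mul0r mul1r; congr Complex; exact: mI.
have a0 : 2 * pi * ((m - k)%:~R * b) != 0.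
  by rewrite !mulf_eq0 intr_eq0 subr_eq0 (negbTE mk) !gt_eqF ?pi_gt0.
have aE : 2 * pi * ((m - k)%:~R * b) * b^-1 = 2 * pi * (m - k)%:~R.
  by field; rewrite gt_eqF.
have ce := congr1 (@complex.Re R) (cis_int (m - k)); rewrite /= in ce.
have se := congr1 (@complex.Im R) (cis_int (m - k)); rewrite /= in se.
by rewrite integral_cos_period ?cell_period ?aE// integral_sin_period ?cell_period ?aE.
Qed.

Lemma bessel_expcell : bessel_family expcell b^-1.
Proof.
move=> f Lf A; set a := fun m => L2inner f (expcell m).
set S := \sum_(i <- A) _.
(* The orthogonal projection of [f] on the span of the finite family; [b] is the inverse of the
   squared norm of each exponential. Expanding the squared norm of [f - u] gives the inequality. *)
pose u x := \sum_(m <- A) (b%:C * a m) * expcell m x.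
have Lm m : L2 (expcell m) := L2_expcell m.
have Lu : L2 u by apply: L2_sum_seq => m; exact: L2Z.
have uk k : k \in A -> L2inner u (expcell k) = a k.
  move=> kA; rewrite /u L2inner_suml// (big_fsetD1 k)//= expcell_ortho eqxx.
  rewrite big_seq big1 ?addr0; last first.
    by move=> m; rewrite !inE => /andP[/negbTE mk _]; rewrite expcell_ortho mk mulr0.
  rewrite mulrAC -rmorphM/= mulfV ?gt_eqF// mul1r//.
have uf : complex.Re (L2inner u f) = b * S.
  rewrite /u L2inner_suml// Re_sum /S mulr_sumr; apply: eq_bigr => m _.
  by rewrite (L2innerC (Lm m) Lf) -/(a m) -mulrA mulconj -rmorphM.
have uu : complex.Re (L2inner u u) = b * S.
  rewrite {1}/u L2inner_suml// Re_sum /S mulr_sumr big_seq [RHS]big_seq.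
  apply: eq_bigr => m mA.
  by rewrite (L2innerC (Lm m) Lu) (uk _ mA) -mulrA mulconj -rmorphM.
have Lfu := L2B Lf Lu.
have ReB (h v k : R -> R[i]) : L2 h -> L2 v -> L2 k ->
    complex.Re (L2inner (fun x => h x - v x) k) =
    complex.Re (L2inner h k) - complex.Re (L2inner v k).
  move=> Lh Lv Lk; rewrite L2innerDl//; last exact: L2N.
  rewrite ReD -ReN -[X in _ = _ + complex.Re X]mulN1r -L2innerZl//.
  by congr (_ + complex.Re (L2inner _ _)); apply/funext => x; rewrite mulN1r.
have ReC (h v : R -> R[i]) : L2 h -> L2 v ->
    complex.Re (L2inner h v) = complex.Re (L2inner v h).
  by move=> Lh Lv; rewrite (L2innerC Lh Lv) conjE.
have : 0 <= complex.Re (L2inner (fun x => f x - u x) (fun x => f x - u x)).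
  by rewrite L2innerff//= fine_ge0// sqnorm_ge0.
rewrite ReB// (ReC f)// (ReC u (fun x => f x - u x))// !ReB//.
rewrite (ReC f u)// uf uu L2innerff//= => h.
by rewrite -(ler_pM2l b0) mulrA divff ?gt_eqF// mul1r; lra.
Qed.

(** A period has finite measure, so L^2 is contained in L^1 there: [u] is its own product with the
    square-integrable [cell]. *)
Lemma cintegrable_L2_cell (u : R -> R[i]) : L2 u -> (forall x, u x = cell x * u x) ->
  cintegrable u.
Proof.
move=> Lu uE.
have Lc : L2 cell.
  rewrite (_ : cell = fun x => cell x * 1); last by apply/funext => x; rewrite mulr1.
  apply: (@L2_cell_bounded _ 1); first exact: cmeasurable_cst.
  by move=> x; rewrite cabsE /= expr0n addr0 expr1n sqrtr1.
have := cintegrable_mulconj Lu Lc.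
rewrite (_ : (fun x => u x * Num.conj (cell x)) = u)//.
by apply/funext => x; rewrite conj_cell mulrC -uE.
Qed.

Lemma cintegrable_bounded_mul (u p : R -> R[i]) (C : R) : cintegrable u ->
  cmeasurable u -> cmeasurable p -> (forall x, cabs (p x) <= C) ->
  cintegrable (fun x => u x * p x).
Proof.
move=> [u1 u2] mu_ mp pC; have C0 : 0 <= C by apply: le_trans (pC 0); exact: cabs_ge0.
apply: (@le_cintegrable _ _
  (fun x => C * (`|complex.Re (u x)| + `|complex.Im (u x)|))).
- exact: cmeasurableM.
- apply: integrable_mulr; apply: integrable_addr; exact: integrable_norm.
- move=> x; rewrite cabsM mulrC; apply: ler_pM; rewrite ?cabs_ge0//.
  exact: cabs_le.
Qed.

(** The bounded multipliers [p] for which all Fourier coefficients of [u p] vanish. Asking this for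
    every [m] makes the class stable under multiplication by exponentials, hence by trigonometric
    polynomials. *)
Definition annihilated (u p : R -> R[i]) :=
  [/\ cmeasurable p, exists C, forall x, cabs (p x) <= C &
    forall m, cintegral (fun x => u x * p x * expi b m x) = 0].

Lemma cintegrable_annihilated (u p : R -> R[i]) m : cmeasurable u -> cintegrable u ->
  annihilated u p -> cintegrable (fun x => u x * p x * expi b m x).
Proof.
move=> mu_ iu [mp [C pC] _].
apply: (@cintegrable_bounded_mul _ _ 1).
- exact: cintegrable_bounded_mul pC.
- exact: cmeasurableM.
- exact: cmeasurable_expi.
- by move=> x; rewrite cabs_expi.
Qed.

Lemma annihilatedD (u p q : R -> R[i]) : cmeasurable u -> cintegrable u ->
  annihilated u p -> annihilated u q -> annihilated u (fun x => p x + q x).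
Proof.
move=> mu_ iu up uq; case: (up) => [mp [C pC] p0]; case: (uq) => [mq [D qD] q0].
split.
- exact: cmeasurableD.
- by exists (C + D) => x; rewrite (le_trans (cabsD _ _))// lerD.
- move=> m; under eq_cintegral do rewrite mulrDr mulrDl.
  by rewrite cintegralD ?p0 ?q0 ?addr0//; exact: cintegrable_annihilated.
Qed.

Lemma annihilatedZ (u p : R -> R[i]) z : cmeasurable u -> cintegrable u ->
  annihilated u p -> annihilated u (fun x => z * p x).
Proof.
move=> mu_ iu up; case: (up) => [mp [C pC] p0]; split.
- by apply: cmeasurableM => //; exact: cmeasurable_cst.
- by exists (cabs z * C) => x; rewrite cabsM ler_wpM2l// cabs_ge0.
- move=> m; rewrite (@eq_cintegral _ _ (fun x => z * (u x * p x * expi b m x))).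
    by rewrite cintegralZ ?p0 ?mulr0//; exact: cintegrable_annihilated.
  by move=> x; ring.
Qed.

Lemma annihilated_expi (u p : R -> R[i]) k :
  annihilated u p -> annihilated u (fun x => p x * expi b k x).
Proof.
move=> [mp [C pC] p0]; split.
- by apply: cmeasurableM => //; exact: cmeasurable_expi.
- by exists C => x; rewrite cabsM cabs_expi mulr1.
- move=> m; rewrite -(p0 (k + m)); apply: eq_cintegral => x.
  by rewrite expiD !mulrA.
Qed.

(* A trigonometric polynomial with values in [0, 1] that is below 1/2 exactly
   when [cos (2 pi b (x - x0)) > cos (2 pi b d)]. *)
Definition bump (x0 d x : R) : R :=
  1 / 2 + (cos (2 * pi * b * d) - cos (2 * pi * b * (x - x0))) / 4.

Lemma bump_bounds x0 d x : 0 <= bump x0 d x <= 1.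
Proof.
rewrite /bump; have := cos_le1 (2 * pi * b * d); have := cos_geN1 (2 * pi * b * d).
have := cos_le1 (2 * pi * b * (x - x0)); have := cos_geN1 (2 * pi * b * (x - x0)).
by move=> *; apply/andP; split; lra.
Qed.

(** Euler's formula for the cosine; the 8 is the 4 of [bump] times the 2 of the half-sum. *)
Lemma bumpE x0 d x : (bump x0 d x)%:C =
  (1 / 2 + cos (2 * pi * b * d) / 4)%:C +
  ((- 8^-1)%:C * cis (- (2 * pi * b * x0))) * expi b 1 x +
  ((- 8^-1)%:C * cis (2 * pi * b * x0)) * expi b (- 1) x.
Proof.
have e1 : cis (- (2 * pi * b * x0)) * expi b 1 x = cis (2 * pi * b * (x - x0)).
  by rewrite /expi -cisD mulr1z; congr cis; ring.
have e2 : cis (2 * pi * b * x0) * expi b (- 1) x = cis (- (2 * pi * b * (x - x0))).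
  by rewrite /expi -cisD mulrN1z; congr cis; ring.
rewrite -[X in _ + X + _]mulrA e1 -[X in _ + _ + X]mulrA e2.
rewrite /bump /cis cosN sinN; simpc; congr Complex; first by field.
by ring.
Qed.

Lemma annihilated_bump (u p : R -> R[i]) x0 d : cmeasurable u -> cintegrable u ->
  annihilated u p -> annihilated u (fun x => p x * (bump x0 d x)%:C).
Proof.
move=> mu_ iu up; rewrite (_ : (fun x => _) = (fun x =>
  (1 / 2 + cos (2 * pi * b * d) / 4)%:C * p x +
  ((- 8^-1)%:C * cis (- (2 * pi * b * x0))) * (p x * expi b 1 x) +
  ((- 8^-1)%:C * cis (2 * pi * b * x0)) * (p x * expi b (- 1) x))); last first.
  by apply/funext => x; rewrite bumpE; ring.
by apply: annihilatedD => //; [apply: annihilatedD => //|];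
  apply: annihilatedZ => //; apply: annihilated_expi.
Qed.

Lemma annihilated_step (u : R -> R[i]) x0 d n : cmeasurable u -> cintegrable u ->
  annihilated u (fun=> 1) -> annihilated u (fun x => (step (bump x0 d x) n)%:C).
Proof.
move=> mu_ iu u1; rewrite /step.
have powP k p : annihilated u p -> annihilated u (fun x => p x * (bump x0 d x ^+ k)%:C).
  elim: k p => [|k IH] p up.
    by under eq_fun do rewrite expr0 mulr1.
  under eq_fun do rewrite exprSr rmorphM /= mulrA.
  by apply: annihilated_bump => //; exact: IH.
elim: (2 ^ n)%N => [|N IH].
  by under eq_fun do rewrite expr0.
(* With q the bump, (1 - q^n)^(N+1) = (1 - q^n)^N - (1 - q^n)^N q^n: only sums and multiplications
   by powers of the bump are needed. *)
rewrite (_ : (fun x => _) = (fun x => ((1 - bump x0 d x ^+ n) ^+ N)%:C +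
   (-1) * (((1 - bump x0 d x ^+ n) ^+ N)%:C * (bump x0 d x ^+ n)%:C))); last first.
  by apply/funext => x; rewrite exprSr mulN1r -rmorphM -rmorphN -rmorphD/=;
    congr (_ %:C); ring.
apply: annihilatedD => //; apply: annihilatedZ => //; exact: powP.
Qed.

(** The ball lies inside the period, so |x - x0| < 1/b - d for [x] in the period. This rules out the
    second arc, near a full turn, on which the cosine is large again. At the two excluded endpoints
    the bump equals 1/2 and the powers have no useful limit. *)
Lemma cvg_step_bump x0 d x : 0 < d -> d < x0 -> x0 + d < b^-1 -> I x ->
  x <> x0 - d -> x <> x0 + d ->
  step (bump x0 d x) @ \oo --> (\1_(ball x0 d) x : R).
Proof.
have bp := b0; have pp := @pi_gt0 R.
move=> d0 dx0 x0d; rewrite /= in_itv/= => /andP[xge0 xb] xl xr.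
have w0 : 0 < 2 * pi * b by rewrite !mulr_gt0.
have wb : 2 * pi * b * b^-1 = 2 * pi by field; rewrite gt_eqF.
have /andP[q0 q1] := bump_bounds x0 d x.
have cabs_ : cos (2 * pi * b * (x - x0)) = cos (2 * pi * b * `|x - x0|).
  by rewrite -cos_norm normrM (gtr0_norm w0).
have wd : 2 * pi * b * d < pi.
  have : 2 * pi * b * (2 * d) < 2 * pi by rewrite -[ltRHS]wb ltr_pM2l//; lra.
  by lra.
have wd0 : 0 < 2 * pi * b * d by rewrite mulr_gt0.
have [xd|xd] := ltP `|x - x0| d.
  rewrite indicE mem_set /=; last by rewrite /ball/= distrC.
  apply: cvg_step_lt => //.
  suff : cos (2 * pi * b * d) < cos (2 * pi * b * (x - x0)) by rewrite /bump; lra.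
  have h : 2 * pi * b * `|x - x0| < 2 * pi * b * d by rewrite ltr_pM2l.
  have h0 : 0 <= 2 * pi * b * `|x - x0| by rewrite mulr_ge0// ltW.
  rewrite cabs_ ltr_cos//; rewrite in_itv/=; apply/andP; split; lra.
have {}xd : d < `|x - x0|.
  rewrite lt_neqAle xd andbT; apply/eqP => dE.
  by move: dE; case: (ger0P (x - x0)) => _ dE; [apply: xr|apply: xl]; lra.
rewrite indicE memNset /=; last by rewrite /ball/= distrC => ?; lra.
apply: cvg_step_gt => //.
suff : cos (2 * pi * b * (x - x0)) < cos (2 * pi * b * d) by rewrite /bump; lra.
have xbd : `|x - x0| < b^-1 - d by rewrite ltr_norml; apply/andP; split; lra.
have h1 : 2 * pi * b * d < 2 * pi * b * `|x - x0| by rewrite ltr_pM2l.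
have h2 : 2 * pi * b * `|x - x0| < 2 * pi - 2 * pi * b * d.
  by rewrite -[X in _ < X - _]wb -mulrBr ltr_pM2l.
rewrite cabs_; have [xpi|xpi] := leP (2 * pi * b * `|x - x0|) pi.
  by rewrite ltr_cos//; rewrite in_itv/=; apply/andP; split; lra.
(* Reflecting the angle to 2 pi minus itself brings it back to [0, pi], where the cosine
   decreases. *)
rewrite -[X in X < _]cosN -(cosD2pi (- _)) mulr2n ltr_cos//.
- by lra.
- by rewrite in_itv/=; apply/andP; split; lra.
- by rewrite in_itv/=; apply/andP; split; lra.
Qed.

End fourier_series.

(** * Uniqueness and convergence of Fourier series, and periodic multipliers *)

Section fourier_uniqueness.
Context {R : realType} (b : R).
Context (b0 : 0 < b).
Local Notation mu := (@lebesgue_measure R).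
Local Notation I := (`[0%R, b^-1[%classic : set R).

Lemma Rintegral_step_lim (v : R -> R) x0 d : measurable_fun setT v ->
  mu.-integrable setT (EFin \o v) ->
  (forall x, ~ I x -> v x = 0) -> 0 < d -> d < x0 -> x0 + d < b^-1 ->
  (forall n, Rintegral mu setT (fun x => v x * step (bump b x0 d x) n) = 0) ->
  Rintegral mu setT (fun x => v x * \1_(ball x0 d) x) = 0.
Proof.
move=> mv iv vI d0 dx0 x0d st0.
have ms n : measurable_fun [set: R] (fun x => step (bump b x0 d x) n).
  rewrite /step; apply: measurable_funX; apply: measurable_funB => //.
  apply: measurable_funX; rewrite /bump; apply: measurable_funD => //.
  apply: measurable_funM => //; apply: measurable_funB => //.
  apply: (measurableT_comp (continuous_measurable_fun (@continuous_cos R))).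
  by apply: measurable_funM => //; exact: measurable_funB.
have mb : measurable_fun [set: R] (\1_(ball x0 d) : R -> R).
  by apply: measurable_indic; exact: measurable_ball.
have [] := @dominated_convergence _ _ _ mu setT measurableT
  (fun n x => (v x * step (bump b x0 d x) n)%:E)
  (fun x => (v x * \1_(ball x0 d) x)%:E) (abse \o (EFin \o v)).
- move=> n; have mn : measurable_fun [set: R] (fun x => (v x * step (bump b x0 d x) n)%:E).
    by apply/measurable_EFinP; exact: measurable_funM.
  exact: mn.
- have mn : measurable_fun [set: R] (fun x => (v x * \1_(ball x0 d) x)%:E).
    by apply/measurable_EFinP; exact: measurable_funM.
  exact: mn.
- have ae1 : {ae mu, forall x, x <> x0 - d}.
    exists [set x0 - d]; split => //; first exact: lebesgue_measure_set1.
    by move=> x /= /contrapT.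
  have ae2 : {ae mu, forall x, x <> x0 + d}.
    exists [set x0 + d]; split => //; first exact: lebesgue_measure_set1.
    by move=> x /= /contrapT.
  apply: (ae_imp (ae_and ae1 ae2)) => x [xl xr] _.
  apply: cvg_EFin; first exact: nearW.
  (* Off the period the bump repeats and the steps need not tend to the indicator of the ball, but
     [v] vanishes there. *)
  have [xI|xI] := pselect (I x).
    by apply: cvgM; [exact: cvg_cst|exact: cvg_step_bump].
  by rewrite /= vI// mul0r; under eq_fun do rewrite mul0r; exact: cvg_cst.
- exact: integrable_abse.
- apply: aeW => x n _; rewrite /= lee_fin normrM ler_piMr//.
  have /andP[s0 s1] := @step_bounds R (bump b x0 d x) n (bump_bounds _ _ _ _).
  by rewrite ger0_norm.
- move=> il _ /= h; rewrite /Rintegral.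
  have lfin := integrable_fin_num measurableT il.
  rewrite -(fineK lfin) in h; move/fine_cvg : h => h.
  rewrite (_ : _ \o _ = cst 0) in h; last by apply/funext => n; exact: st0.
  by rewrite -(cvg_lim _ h)// lim_cst.
Qed.

(** When [v] has zero mean on a ball around [x], the mean of |v - v x| over it is at least |v x|; at
    a Lebesgue point these means tend to 0. *)
Lemma lebesgue_pt_eq0 (v : R -> R) (x : R) : measurable_fun setT v ->
  mu.-integrable setT (EFin \o v) ->
  (exists2 d0 : R, 0 < d0 & forall d, 0 < d -> d < d0 ->
    Rintegral mu setT (fun y => v y * \1_(ball x d) y) = 0) ->
  lebesgue_pt v x -> v x = 0.
Proof.
move=> mv iv [d0 d00 vd] lp.
have ge (r : R) : 0 < r -> r < d0 -> (`|v x|%:E <= davg v x r)%E.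
  move=> r0 rd; rewrite /davg /iavg.
  have mB : measurable (ball x r) by exact: measurable_ball.
  have muB : (mu (ball x r) = (r *+ 2)%:E)%E by exact: lebesgue_measure_ball (ltW r0).
  have ivB : mu.-integrable (ball x r) (EFin \o v).
    exact: integrableS iv.
  have icB : mu.-integrable (ball x r) (EFin \o cst (v x)).
    apply/integrableP; split; first exact/measurable_EFinP.
    have -> : (\int[mu]_(y in ball x r) `|(EFin \o cst (v x)) y| =
      \int[mu]_(y in ball x r) (cst `|v x|%:E) y)%E by exact: eq_integral.
    by rewrite integral_cst// [X in (_ * X < _)%E]muB -EFinM ltry.
  have cB : (\int[mu]_(y in ball x r) (cst (v x) y)%:E = (v x * (r *+ 2))%:E)%E.
    have -> : (\int[mu]_(y in ball x r) (cst (v x) y)%:E =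
      \int[mu]_(y in ball x r) (cst (v x)%:E) y)%E by exact: eq_integral.
    by rewrite integral_cst// [X in (_ * X = _)%E]muB.
  have vB : (\int[mu]_(y in ball x r) (v y)%:E = 0)%E.
    rewrite -[LHS]fineK; last exact: integrable_fin_num.
    apply: (congr1 EFin); rewrite -[LHS]/(Rintegral mu (ball x r) v).
    rewrite Rintegral_mkcond -[RHS](vd _ r0 rd); apply: eq_Rintegral => y _.
    by rewrite patchE indicE; case: (y \in _); rewrite ?mulr1 ?mulr0.
  have E : (\int[mu]_(y in ball x r) (v y - v x)%:E = - (v x * (r *+ 2))%:E)%E.
    by rewrite integralB_EFin// vB cB sub0e.
  have mvx : measurable_fun (ball x r : set (measurableTypeR R))
      (fun y => (v y - v x)%:E).
    apply/measurable_EFinP; apply: measurable_funB => //.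
    exact: measurable_funS mv.
  have := @le_abse_integral _ (measurableTypeR R) _ mu _ _ mB mvx.
  rewrite E abseN abse_EFin.
  have r20 : 0 < r *+ 2 by rewrite mulrn_wgt0.
  rewrite normrM (gtr0_norm r20) => h.
  by rewrite muB inver gt_eqF// muleC lee_pdivlMr.
apply/eqP; rewrite -normr_le0 -lee_fin.
apply: (@cvge_ge _ _ _ _ _ _ _ _ lp).
near=> r; apply: ge; first by near: r; exact: nbhs_right_gt.
by near: r; exact: nbhs_right_lt.
Unshelve. all: by end_near. Qed.

Lemma real_fourier_unique (v : R -> R) : measurable_fun setT v ->
  mu.-integrable setT (EFin \o v) -> (forall x, ~ I x -> v x = 0) ->
  (forall x0 d n, 0 < d -> d < x0 -> x0 + d < b^-1 ->
    Rintegral mu setT (fun x => v x * step (bump b x0 d x) n) = 0) ->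
  {ae mu, forall x, v x = 0}.
Proof.
have bp := b0; move=> mv iv vI st0.
have lv : locally_integrable setT v by apply: open_integrable_locally => //; exact: openT.
(* The point 0 belongs to the half-open period but no ball around it stays inside. *)
have ae0 : {ae mu, forall x, x <> 0}.
  exists [set 0]; split => //; first exact: lebesgue_measure_set1.
  by move=> x /= /contrapT.
apply: (ae_imp (ae_and (lebesgue_differentiation lv) ae0)) => x [lp xn0].
have [xI|/vI//] := pselect (I x); move: xI; rewrite /= in_itv/= => /andP[x0 xb].
have {}x0 : 0 < x by rewrite lt_neqAle x0 andbT eq_sym; apply/eqP.
apply: lebesgue_pt_eq0 lp => //; exists (Num.min x (b^-1 - x)).
  by rewrite lt_min x0 subr_gt0.
move=> d d0; rewrite lt_min => /andP[dx xd].
have xdb : x + d < b^-1 by lra.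
by apply: Rintegral_step_lim => // n; exact: st0.
Qed.

Lemma fourier_unique (u : R -> R[i]) : L2 u -> (forall x, u x = cell b x * u x) ->
  (forall m, L2inner u (expcell b m) = 0) -> {ae mu, forall x, u x = 0}.
Proof.
move=> Lu uE u0; have iu := cintegrable_L2_cell b0 Lu uE; have mu_ := L2_cmeas Lu.
have uI x : ~ I x -> u x = 0.
  by move=> xI; rewrite uE /cell indicE memNset// mul0r.
have u1 : annihilated b u (fun=> 1).
  split; first exact: cmeasurable_cst.
    by exists 1 => x; rewrite cabsE /= expr0n addr0 expr1n sqrtr1.
  move=> m; rewrite -(u0 (- m)); apply: eq_cintegral => x.
  by rewrite /expcell rmorphM/= conj_cell conj_expi opprK mulr1 [in LHS]uE; ring.
(* The coefficient of index 0 of the product is its integral. *)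
have st x0 d n : cintegral (fun x => u x * (step (bump b x0 d x) n)%:C) = 0.
  have [_ _ /(_ 0) h] := annihilated_step x0 d n mu_ iu u1.
  by rewrite -h; apply: eq_cintegral => x; rewrite expi0 mulr1.
have [[i1 i2] [m1 m2]] := (iu, mu_).
have aeR : {ae mu, forall x, complex.Re (u x) = 0}.
  apply: real_fourier_unique => // [x /uI -> //|x0 d n _ _ _].
  have /(congr1 (@complex.Re R)) /= h := st x0 d n; rewrite -[RHS]h.
  by apply: eq_Rintegral => x _; rewrite ReM /= mulr0 subr0.
have aeI : {ae mu, forall x, complex.Im (u x) = 0}.
  apply: real_fourier_unique => // [x /uI -> //|x0 d n _ _ _].
  have /(congr1 (@complex.Im R)) /= h := st x0 d n; rewrite -[RHS]h.
  by apply: eq_Rintegral => x _; rewrite ImM /= mulr0 add0r.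
by apply: (ae_imp (ae_and aeR aeI)) => x [ux1 ux2]; exact: complexP.
Qed.

(** Continuity of the inner product, in the case needed for orthogonal families: the pairings with
    the partial sums are eventually constant. *)
Lemma L2_sum_inner (J : choiceType) (w : J -> R -> R[i]) s h z : L2_sum w s -> L2 h ->
  (exists A0 : {fset J}, forall A : {fset J}, (A0 `<=` A)%fset ->
    L2inner (fun x => \sum_(i <- A) w i x) h = z) ->
  L2inner s h = z.
Proof.
move=> /L2_sumP[Lw Ls ws] Lh [A0 A0z].
apply/eqP; rewrite -subr_eq0; apply/eqP/ComplexField.eq0_normC.
rewrite -norm_cabs; apply/eqP; rewrite norm_cabs eq_complex /= eqxx andbT.
rewrite eq_le cabs_ge0 andbT; apply/ler_addgt0Pr => e e0; rewrite add0r.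
set q := fine (sqnorm h); have q0 : 0 <= q by rewrite fine_ge0// sqnorm_ge0.
(* This weight makes q / t at most e / 4, and the threshold e / (4 t) does the same for the other
   term; the factor 2 of [cabs_L2inner_le] then leaves at most [e]. The added 1 keeps [t] positive
   when [q] is 0. *)
pose t := (4 * q + 1) / e; have t0 : 0 < t by rewrite divr_gt0//; lra.
have et : 0 < e / (4 * t) by rewrite divr_gt0// mulr_gt0.
have [A1 A1P] := ws _ et.
pose A := (A0 `|` A1)%fset.
have LS : L2 (fun x => \sum_(i <- A) w i x) by exact: L2_sum_seq.
have LD := L2B LS Ls.
have E : L2inner s h - z = - L2inner (fun x => \sum_(i <- A) w i x - s x) h.
  rewrite L2innerDl//; last exact: L2N.
  rewrite A0z ?fsubsetUl// opprD addrC; congr (_ + _).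
  rewrite -[RHS]mulN1r -L2innerZl//; last exact: L2N.
  by congr L2inner; apply/funext => x; rewrite mulN1r opprK.
rewrite E cabsN; apply: le_trans (cabs_L2inner_le t0 LD Lh) _.
have : fine (sqnorm (fun x => \sum_(i <- A) w i x - s x)) <= e / (4 * t).
  by rewrite -lee_fin fineK ?sqnorm_fin//; apply: A1P; exact: fsubsetUr.
rewrite -(ler_pM2l t0) -/q => h1.
have : t * (e / (4 * t)) = e / 4 by field; rewrite gt_eqF.
have : t^-1 * q <= e / 4.
  rewrite /t invf_div mulrAC ler_pdivrMr; last by lra.
  by nra.
by lra.
Qed.

(** The Bessel inequality gives convergence to some limit, orthogonality gives the coefficients of
    that limit, and uniqueness of coefficients identifies it. *)
Lemma fourier_series_cvg (F : R -> R[i]) (C : R) : cmeasurable F ->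
  (forall x, cabs (F x) <= C) ->
  L2_sum (fun m x => L2inner (fun y => cell b y * F y) (expcell b m) * expcell b m x)
    (fun x => (b^-1)%:C * (cell b x * F x)).
Proof.
move=> mF FC; have Lf := L2_cell_bounded b0 mF FC.
have Lphi := L2_expcell b0.
have bi0 : 0 < b^-1 by rewrite invr_gt0.
have [s0 /L2_sumP[Lu Ls0 us0]] := bessel_L2_sum bi0 Lphi (bessel_expcell b0) Lf.
(* The limit [s0] is determined only up to a null set, while uniqueness requires support in the
   period. Cutting by [cell] fixes the partial sums and does not increase the error. *)
pose f x := cell b x * F x; pose s x := cell b x * s0 x.
pose a m := L2inner f (expcell b m).
have Ls : L2 s.
  have ms0 := L2_cmeas Ls0.
  apply: le_L2 Ls0 _; first by apply: cmeasurableM; [exact: cmeasurable_cell|exact: ms0].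
  by move=> x; rewrite cabsM ler_piMl ?cabs_ge0 ?cabs_cell_le1.
have us : L2_sum (fun m x => a m * expcell b m x) s.
  apply/L2_sumP; split => // e e0; have [A0 A0P] := us0 _ e0.
  exists A0 => A /A0P; apply: le_trans; apply: le_sqnorm.
  - by apply: cmeasurableB; [apply: cmeasurable_sum => i; exact: (L2_cmeas (Lu i))|exact: (L2_cmeas Ls)].
  - by apply: cmeasurableB; [apply: cmeasurable_sum => i; exact: (L2_cmeas (Lu i))|exact: (L2_cmeas Ls0)].
  - move=> x; rewrite [X in cabs (X - _)](_ : _ =
      cell b x * \sum_(i <- A) a i * expcell b i x); last first.
      rewrite mulr_sumr; apply: eq_bigr => i _.
      by rewrite /expcell -{1}(cell_idem b x); ring.
    by rewrite -mulrBr cabsM ler_piMl ?cabs_ge0 ?cabs_cell_le1.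
have sk k : L2inner s (expcell b k) = (b^-1)%:C * a k.
  apply: (L2_sum_inner us (Lphi k)); exists [fset k]%fset => A kA.
  rewrite L2inner_suml// (big_fsetD1 k)//=; last by rewrite -fsub1set.
  rewrite expcell_ortho// eqxx big_seq big1 ?addr0 1?mulrC// => m.
  by rewrite !inE => /andP[/negbTE mk _]; rewrite expcell_ortho// mk mulr0.
have Lbf : L2 (fun x => (b^-1)%:C * f x) by exact: L2Z.
have ae0 : {ae mu, forall x, s x - (b^-1)%:C * f x = 0}.
  apply: fourier_unique; first exact: L2B.
    by move=> x; rewrite /s /f -[in LHS](cell_idem b x); ring.
  move=> m; rewrite L2innerDl//; last exact: L2N.
  rewrite sk (_ : (fun x => - _) = (fun x => (- (b^-1)%:C) * f x)); last first.
    by apply/funext => x; rewrite mulNr.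
  by rewrite L2innerZl// mulNr subrr.
have /L2_sumP[_ _ usP] := us.
apply/L2_sumP; split => // e e0; have [A0 A0P] := usP _ e0.
exists A0 => A /A0P; rewrite (@ae_eq_sqnorm _ _
  (fun x => \sum_(i <- A) a i * expcell b i x - (b^-1)%:C * f x))//.
- by apply: cmeasurableB; [apply: cmeasurable_sum => i; exact: (L2_cmeas (Lu i))|exact: (L2_cmeas Ls)].
- by apply: cmeasurableB; [apply: cmeasurable_sum => i; exact: (L2_cmeas (Lu i))|exact: (L2_cmeas Lbf)].
- by apply: (ae_imp ae0) => x /eqP; rewrite subr_eq0 => /eqP ->.
Qed.

(** After unfolding, the periodic factor |psi|^2 comes out of the sum over translates, and what is
    left is bounded by [C]. Working on finite windows avoids the infinite periodisation of |w|^2. *)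
Lemma sqnorm_periodic_mul (psi w : R -> R[i]) (C : R) :
  cmeasurable psi -> (forall (k : int) x, psi (x - k%:~R * b^-1) = psi x) ->
  cmeasurable w -> 0 <= C ->
  {ae mu, forall x, forall N, \sum_(i < N)
    (cabs (w (x - (Posz i)%:~R * b^-1)) ^+ 2 +
     cabs (w (x - (Negz i)%:~R * b^-1)) ^+ 2) <= C} ->
  (sqnorm (fun x => psi x * w x)%R <= C%:E * sqnorm (fun x => cell b x * psi x)%R)%E.
Proof.
move=> mpsi ppsi mw C0 aeC.
have bi0 : 0 < b^-1 by rewrite invr_gt0.
have mpw : cmeasurable (fun x => psi x * w x) by exact: cmeasurableM.
pose h x := (cabs (psi x * w x) ^+ 2)%:E.
have mh : measurable_fun [set: R] h by exact: measurable_sqr_cabs.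
have mht (t : R) : measurable_fun [set: R] (fun x => h (x - t)).
  exact: (measurableT_comp mh (measurable_translate t)).
have h0 x : (0 <= h x)%E by rewrite lee_fin sqr_ge0.
apply: (ge0_integral_window_le bi0 mh h0) => N.
rewrite integral_window//.
have mI : measurable I by exact: measurable_itv.
have mhI t : measurable_fun I (fun x => h (x - t)) by exact: measurable_funS (mht t).
rewrite (eq_bigr (fun i : 'I_N => \int[mu]_(x in I)
    (h (x - (Posz i)%:~R * b^-1)%R + h (x - (Negz i)%:~R * b^-1)%R))%E); last first.
  by move=> i _; rewrite ge0_integralD//; exact: mhI.
rewrite -ge0_integral_sum//; first last.
- by move=> i x _; rewrite adde_ge0.
- by move=> i; apply: emeasurable_funD; exact: mhI.
have mcp : cmeasurable (fun x => cell b x * psi x).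
  by apply: cmeasurableM => //; exact: cmeasurable_cell.
have -> : sqnorm (fun x => cell b x * psi x) = (\int[mu]_(x in I) (cabs (psi x) ^+ 2)%:E)%E.
  rewrite [RHS]integral_mkcond; apply: eq_integral => x _.
  rewrite patchE cabsM cabs_cell indicE; case: (x \in I); rewrite ?mul1r//.
  by rewrite mul0r expr0n.
have mp2 : measurable_fun I (fun x => (cabs (psi x) ^+ 2)%:E).
  by apply: measurable_funS (measurable_sqr_cabs mpsi).
rewrite -ge0_integralZl//; last by move=> x _; rewrite lee_fin sqr_ge0.
apply: ae_ge0_le_integral => //.
- by move=> x _; apply: sume_ge0 => i _; rewrite adde_ge0.
- by apply: emeasurable_sum => i; apply: emeasurable_funD; exact: mhI.
- by move=> x _; rewrite mule_ge0// lee_fin// sqr_ge0.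
- exact: measurable_funeM.
apply: (ae_imp aeC) => x /(_ N) xC _.
rewrite /h; under eq_bigr do rewrite -EFinD !ppsi !cabsM !exprMn -mulrDr.
rewrite sumEFin -EFinM lee_fin -mulr_sumr mulrC ler_wpM2r// sqr_ge0//.
Qed.

End fourier_uniqueness.

(** * Unconditional sums over the integers and brackets *)

#[local] Existing Instance totally_filter.

Section integer_families.
Context {R : realType}.
Implicit Types T : int -> R[i].

Definition abs_summable T := exists M, forall A : {fset int}, \sum_(k <- A) cabs (T k) <= M.

(** The indices of the cells forming [window N]. Exhausting the integers by this sequence turns
    unconditional sums into sequential limits, as measurability and dominated convergence
    require. *)
Fixpoint int_window (N : nat) : {fset int} :=
  if N is n.+1 then (Posz n |` (Negz n |` int_window n))%fset else fset0.

Lemma in_int_window N k :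
  (k \in int_window N) = (match k with Posz n => n < N | Negz n => n < N end)%N.
Proof.
elim: N => [|N IH] /=; first by rewrite in_fset0; case: k.
rewrite !in_fset1U {}IH; case: k => n.
  by rewrite ltnS [in RHS]leq_eqVlt -eqz_nat; case: (Posz n == N).
have -> : (Negz n == Negz N) = (n == N) by apply/eqP/eqP => [[]|->].
by rewrite ltnS [in RHS]leq_eqVlt.
Qed.

Lemma partial_sumE (V : zmodType) (u : int -> V) (A : {fset int}) :
  partial_sum u A = \sum_(k <- A) u k.
Proof. by rewrite /partial_sum big_seq_fsetE. Qed.

Lemma sum_int_window (V : nmodType) (u : int -> V) N :
  \sum_(k <- int_window N) u k = \sum_(i < N) (u (Posz i) + u (Negz i)).
Proof.
elim: N => [|N IH]; first by rewrite big_ord0 big_seq_fset0.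
rewrite big_ord_recr /= -IH !big_fsetU1/= ?addrA; first by rewrite addrC addrA.
  by rewrite in_int_window ltnn.
by rewrite in_fset1U in_int_window ltnn.
Qed.

Lemma subset_int_window (A : {fset int}) :
  exists N0, forall N, (N0 <= N)%N -> (A `<=` int_window N)%fset.
Proof.
pose idx k := (match k with Posz n => n | Negz n => n end)%N.
exists (\max_(k <- A) (idx k)).+1 => N NA; apply/fsubsetP => k kA.
have : (idx k < N)%N.
  by apply: leq_trans NA; rewrite ltnS; apply: leq_bigmax_seq.
by rewrite in_int_window; case: k {kA}.
Qed.

Lemma cvg_int_window : int_window @ \oo --> @totally int.
Proof.
move=> P [A _ AP]; have [N0 N0P] := subset_int_window A.
by exists N0 => // N /N0P h; apply: AP.
Qed.

Lemma abs_summable_cvg T : abs_summable T ->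
  exists z : R[i], partial_sum (T : int -> R[i]^o) @ totally --> (z : R[i]^o).
Proof.
move=> [M TM].
have rcvg (u : int -> R) : (forall k, `|u k| <= cabs (T k)) ->
    exists l : R, forall e, 0 < e -> exists A0 : {fset int}, forall A : {fset int},
      (A0 `<=` A)%fset -> `|l - \sum_(k <- A) u k| <= e.
  move=> uT.
  have tail := @summable_tail R int _ M (fun k => cabs_ge0 (T k)) TM.
  pose S (A : {fset int}) : R := \sum_(k <- A) u k.
  have : cvg (S @ totally).
    apply/cauchy_cvgP/cauchy_exP => e e0.
    have e20 : 0 < e / 2 by rewrite divr_gt0.
    have [A0 A0P] := tail _ e20; exists (S A0); exists A0 => // A /= AA.
    rewrite /ball /= /S (sum_fsetD _ AA) opprD addrA subrr add0r normrN.
    apply: (@le_lt_trans _ _ (e / 2)); last by rewrite ltr_pdivrMr// ltr_pMr// ltr1n.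
    apply: le_trans (A0P A); apply: le_trans (ler_norm_sum _ _ _) _.
    exact: ler_sum.
  move=> /cvg_ex[l Sl]; exists l => e e0.
  move/cvgrPdist_le : Sl => /(_ e e0) [A0 _ A0P].
  by exists A0 => A /A0P.
have [l1 l1P] := rcvg (fun k => complex.Re (T k)) (fun k => norm_Re_le _).
have [l2 l2P] := rcvg (fun k => complex.Im (T k)) (fun k => norm_Im_le _).
exists (Complex l1 l2); apply/cvgrPdist_le => /= e.
(* In the order of [R[i]], a positive element is real with positive real part. *)
rewrite ltcE /= => /andP[/eqP ei er].
have er2 : 0 < complex.Re e / 2 by rewrite divr_gt0.
have [A1 A1P] := l1P _ er2; have [A2 A2P] := l2P _ er2.
exists (A1 `|` A2)%fset => // A /=; rewrite fsubUset => /andP[/A1P h1 /A2P h2].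
rewrite norm_cabs lecE /= ei eqxx /=.
apply: le_trans (cabs_le _) _; rewrite ReD ImD ReN ImN.
rewrite partial_sumE Re_sum Im_sum.
by rewrite (splitr (complex.Re e)) lerD.
Qed.

(** Finite sums away from [A0] are differences of two sums within 1 of the limit, hence bounded by
    2. Splitting by sign gives 4 for absolute values of a real family, and 8 for a complex one. Thus
    [sum] takes its default value wherever absolute convergence fails. *)
Lemma cvg_abs_summable T : cvg (partial_sum (T : int -> R[i]^o) @ totally) ->
  abs_summable T.
Proof.
move=> /cvg_ex[z /cvgrPdist_le /(_ 1 ltr01) [A0 _ A0P]].
have small (A : {fset int}) : [disjoint A & A0]%fset -> cabs (\sum_(k <- A) T k) <= 2.
  move=> dA.
  have E : \sum_(k <- A) T k = (z - \sum_(k <- A0) T k) - (z - \sum_(k <- (A0 `|` A)%fset) T k).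
    rewrite (sum_fsetD _ (fsubsetUl A0 A)) fsetDUl fsetDv fset0U (fsetDidPl _ _ dA).
    by rewrite opprB [in RHS]addrC addrA subrK addrAC subrr add0r.
  have nE (B : {fset int}) : (A0 `<=` B)%fset -> cabs (z - \sum_(k <- B) T k) <= 1.
    by move=> /A0P /=; rewrite norm_cabs partial_sumE lecE /= => /andP[].
  rewrite E; apply: le_trans (cabsD _ _) _; rewrite cabsN.
  by rewrite (_ : 2 = 1 + 1)//; apply: lerD; apply: nE; rewrite ?fsubsetUl.
have abs1 (u : int -> R) : (forall A : {fset int}, [disjoint A & A0]%fset ->
    `|\sum_(k <- A) u k| <= 2) ->
  forall A : {fset int}, [disjoint A & A0]%fset -> \sum_(k <- A) `|u k| <= 4.
  move=> us A dA.
  rewrite (big_fsetID _ (fun k => 0 <= u k))/=.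
  have dS (P : pred int) : [disjoint [fset k in A | P k] & A0]%fset.
    by apply: fdisjointWl dA; apply/fsubsetP => k; rewrite !inE => /andP[].
  rewrite (_ : 4 = 2 + 2); last by rewrite -natrD.
  apply: lerD.
  - apply: le_trans (us _ (dS (fun k => 0 <= u k))).
    apply: le_trans (ler_norm _); rewrite big_seq [leRHS]big_seq; apply: ler_sum => k.
    by rewrite !inE => /andP[_ k0]; rewrite ger0_norm.
  - apply: le_trans (us _ (dS (fun k => ~~ (0 <= u k)))).
    apply: le_trans (ler_norm _) _; rewrite -[leRHS]normrN -sumrN.
    apply: le_trans (ler_norm _); rewrite ger0_norm ?sumr_ge0//.
    rewrite big_seq [leRHS]big_seq; apply: ler_sum => k.
    by rewrite !inE -ltNge => /andP[_ k0]; rewrite ltr0_norm.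
exists (8 + \sum_(k <- A0) cabs (T k)) => A.
apply: (@le_trans _ _ (\sum_(k <- (A0 `|` A)%fset) cabs (T k))).
  rewrite (sum_fsetD (fun k => cabs (T k)) (fsubsetUr A0 A)) lerDl.
  by apply: sumr_ge0 => k _; exact: cabs_ge0.
rewrite (sum_fsetD _ (fsubsetUl A0 A)) addrC lerD2r fsetDUl fsetDv fset0U.
have dD : [disjoint (A `\` A0) & A0]%fset by apply/fdisjointP => k; rewrite !inE => /andP[].
apply: (@le_trans _ _ (\sum_(k <- (A `\` A0)%fset) (`|complex.Re (T k)| + `|complex.Im (T k)|))).
  by apply: ler_sum => k _; exact: cabs_le.
rewrite big_split /= (_ : 8 = 4 + 4); last by rewrite -natrD.
apply: lerD; apply: abs1 => // B dB.
- by rewrite -Re_sum (le_trans (norm_Re_le _))// small.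
- by rewrite -Im_sum (le_trans (norm_Im_le _))// small.
Qed.

Lemma sum_cvg T : abs_summable T ->
  (fun N : nat => complex.Re (\sum_(i < N) (T (Posz i) + T (Negz i)))) @ \oo
    --> complex.Re (summability.sum (T : int -> R[i]^o)) /\
  (fun N : nat => complex.Im (\sum_(i < N) (T (Posz i) + T (Negz i)))) @ \oo
    --> complex.Im (summability.sum (T : int -> R[i]^o)).
Proof.
move=> /abs_summable_cvg[z Tz].
have -> : summability.sum (T : int -> R[i]^o) = z.
  by rewrite /summability.sum; apply: cvg_lim Tz; exact: norm_hausdorff.
have TzN : (fun N : nat => \sum_(i < N) (T (Posz i) + T (Negz i)) : R[i]^o) @ \oo --> (z : R[i]^o).
  have := cvg_comp _ _ cvg_int_window Tz.
  apply: cvg_trans; apply: near_eq_cvg; apply: nearW => N.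
  by rewrite /= partial_sumE sum_int_window.
move/cvgrPdist_le : TzN => TzN.
split; apply/cvgrPdist_le => e e0; have ec : 0 < e%:C by rewrite ltcR.
- have := TzN _ ec; apply: filterS => N; rewrite norm_cabs lecR; apply: le_trans.
  by rewrite -ReN -ReD norm_Re_le.
- have := TzN _ ec; apply: filterS => N; rewrite norm_cabs lecR; apply: le_trans.
  by rewrite -ImN -ImD norm_Im_le.
Qed.

Lemma sum_default T : ~ abs_summable T -> summability.sum (T : int -> R[i]^o) = point.
Proof. by move=> nT; apply: dvgP => /cvg_abs_summable. Qed.

(** The two families of partial sums have the same image filter, so the limits agree even when both
    are the default value. This makes brackets periodic at every point, and not only almost
    everywhere. *)
Lemma sum_reindex T (s t : int -> int) : cancel s t -> cancel t s ->
  summability.sum (fun k => T (s k) : R[i]^o) = summability.sum (T : int -> R[i]^o).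
Proof.
move=> st ts; rewrite /summability.sum; congr (lim _); apply/seteqP.
have key (T' : int -> R[i]^o) (s' t' : int -> int) : cancel s' t' -> cancel t' s' ->
    partial_sum (fun k => T' (s' k)) @ totally `<=` partial_sum T' @ totally.
  move=> st' ts' P [A0 _ A0P].
  exists [fset s' k | k in A0]%fset => // A /= AA.
  have -> : partial_sum T' A = partial_sum (fun k => T' (s' k)) [fset t' k | k in A]%fset.
    rewrite !partial_sumE big_imfset/=.
      by apply: eq_bigr => k _; rewrite ts'.
    by move=> x y _ _; exact: can_inj ts' x y.
  apply: A0P => /=; apply/fsubsetP => k kA.
  rewrite -(st' k); apply: in_imfset; apply: (fsubsetP AA); exact: in_imfset.
split; first exact: key st ts.
have := key (fun k => T (s k)) t s ts st.
rewrite (_ : (fun k => T (s (t k))) = T)//.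
by apply/funext => k; rewrite ts.
Qed.

End integer_families.

(** * Periodicity, measurability and bounds of brackets *)

Section brackets.
Context {R : realType} (c : R).
Context (c0 : 0 < c).
Local Notation mu := (@lebesgue_measure R).
Implicit Types f h : R -> R[i].

Definition bterm f h x : int -> R[i] :=
  fun k => f (x - k%:~R * c) * Num.conj (h (x - k%:~R * c)).

Lemma bracketE f h x : bracket c f h x = summability.sum (bterm f h x : int -> R[i]^o).
Proof. by []. Qed.

Lemma bracket_periodic f h (j : int) x : bracket c f h (x - j%:~R * c) = bracket c f h x.
Proof.
rewrite !bracketE.
rewrite -(@sum_reindex _ (bterm f h x) (fun k => k + j) (fun k => k - j)).
- have -> : bterm f h (x - j%:~R * c) = (fun k => bterm f h x (k + j)).
    apply/funext => k; rewrite /bterm.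
    by have -> : x - j%:~R * c - k%:~R * c = x - (k + j)%:~R * c by rewrite rmorphD/=; ring.
  by [].
- by move=> k; rewrite addrK.
- by move=> k; rewrite subrK.
Qed.

Lemma cmeasurable_shift f (t : R) : cmeasurable f -> cmeasurable (fun x => f (x - t)).
Proof. exact: cmeasurable_translation. Qed.

Lemma cmeasurable_bterm f h k : cmeasurable f -> cmeasurable h ->
  cmeasurable (fun x => bterm f h x k).
Proof.
move=> mf mh; apply: cmeasurableM; first exact: cmeasurable_shift.
by apply: cmeasurable_conj; exact: cmeasurable_shift.
Qed.

(** As a series of non-negative terms, the condition defines a measurable set of points when the
    terms are measurable functions. *)
Lemma abs_summableP (T : int -> R[i]) : abs_summable T <->
  (\sum_(0 <= i <oo) (cabs (T (Posz i)) + cabs (T (Negz i)))%:E < +oo)%E.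
Proof.
have T0 (i : nat) : (0 <= (cabs (T (Posz i)) + cabs (T (Negz i)))%:E)%E.
  by rewrite lee_fin addr_ge0// cabs_ge0.
have E N : (\sum_(0 <= i < N) (cabs (T (Posz i)) + cabs (T (Negz i)))%:E =
    (\sum_(k <- int_window N) cabs (T k))%:E)%E.
  by rewrite sumEFin sum_int_window big_mkord.
split=> [[M TM]|].
  apply: (@le_lt_trans _ _ M%:E); last exact: ltry.
  apply: lime_le; first exact: is_cvg_nneseries.
  by apply: nearW => N; rewrite E lee_fin.
set S := (\sum_(0 <= i <oo) _)%E => Soo.
have S0 : (0 <= S)%E by exact: nneseries_ge0.
have fS : S \is a fin_num by rewrite ge0_fin_numE.
exists (fine S) => A; have [N NA] := subset_int_window A.
rewrite -lee_fin (fineK fS).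
apply: (@le_trans _ _ (\sum_(k <- int_window N) cabs (T k))%:E).
  rewrite lee_fin (sum_fsetD _ (NA N (leqnn N))) lerDl.
  by apply: sumr_ge0 => k _; exact: cabs_ge0.
by rewrite -E; apply: nneseries_lim_ge.
Qed.

Lemma cmeasurable_bracket f h : cmeasurable f -> cmeasurable h ->
  cmeasurable (bracket c f h).
Proof.
move=> mf mh; pose T := bterm f h.
pose G x : \bar R := (\sum_(0 <= i <oo) (cabs (T x (Posz i)) + cabs (T x (Negz i)))%:E)%E.
have mT k : cmeasurable (fun x => T x k) by exact: cmeasurable_bterm.
have mG : measurable_fun setT G.
  apply: ge0_emeasurable_sum => [k x _ _|k _].
    by rewrite lee_fin addr_ge0// cabs_ge0.
  by apply/measurable_EFinP; apply: measurable_funD; exact: measurable_cabs.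
pose E := [set x | (G x < +oo)%E].
have mE : measurable E by rewrite -[E]setTI; apply: emeasurable_fun_infty_o.
(* Off [E] the sum does not converge and takes the junk value [point]. *)
pose p : R[i] := (point : R[i]^o).
(* With the default value inserted off [E], these sums converge to the bracket at every point. *)
pose S N x := (\1_E x)%:C * (\sum_(i < N) (T x (Posz i) + T x (Negz i))) +
  (\1_(~` E) x)%:C * p.
have mS N : cmeasurable (S N).
  apply: cmeasurableD; apply: cmeasurableM.
  - by apply: cmeasurable_real; exact: measurable_indic.
  - by apply: cmeasurable_sum => i; exact: cmeasurableD.
  - by apply: cmeasurable_real; apply: measurable_indic; exact: measurableC.
  - exact: cmeasurable_cst.
have SE x N : (G x < +oo)%E -> S N x = \sum_(i < N) (T x (Posz i) + T x (Negz i)).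
  move=> xE; rewrite /S !indicE mem_set// memNset ?mul1r ?mul0r ?addr0//.
have SNE x N : ~ (G x < +oo)%E -> S N x = p.
  move=> xE; rewrite /S !indicE memNset// mem_set// mul0r add0r mul1r//.
have cvgS x : (fun N => complex.Re (S N x)) @ \oo --> complex.Re (bracket c f h x) /\
    (fun N => complex.Im (S N x)) @ \oo --> complex.Im (bracket c f h x).
  have [xE|xE] := pselect (G x < +oo)%E.
    have [h1 h2] := @sum_cvg _ (T x) ((abs_summableP _).2 xE).
    by split; under eq_fun do rewrite SE//; [exact: h1|exact: h2].
  rewrite bracketE sum_default; last by move=> /abs_summableP.
  by split; under eq_fun do rewrite SNE//; exact: cvg_cst.
split.
- apply: (@measurable_fun_cvg _ _ _ _ (fun N x => complex.Re (S N x))).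
    by move=> N; case: (mS N).
  by move=> x _; case: (cvgS x).
- apply: (@measurable_fun_cvg _ _ _ _ (fun N x => complex.Im (S N x))).
    by move=> N; case: (mS N).
  by move=> x _; case: (cvgS x).
Qed.

Lemma le_sum_esum (J : choiceType) (d : J -> R) (A : {fset J}) : (forall j, 0 <= d j) ->
  ((\sum_(j <- A) d j)%:E <= \esum_(j in [set: J]) (d j)%:E)%E.
Proof.
move=> d0; apply: esum_ge; exists [set` A]; first by split.
by rewrite fsbig_finite//= set_fsetK sumEFin.
Qed.

(** The form in which membership in [Linf_l2] is used: almost everywhere on the whole line, with a
    bound uniform over finite sets in place of an extended-real sum. *)
Definition ae_square_summable (C : R) f :=
  {ae mu, forall x, forall A : {fset int},
    \sum_(k <- A) cabs (f (x - k%:~R * c)) ^+ 2 <= C}.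

Lemma ae_int (P : int -> R -> Prop) : (forall k, {ae mu, forall x, P k x}) ->
  {ae mu, forall x, forall k, P k x}.
Proof.
move=> aeP; have p1 : {ae mu, forall x, forall n : nat, P (Posz n) x}.
  by apply: ae_foralln => n; exact: aeP.
have p2 : {ae mu, forall x, forall n : nat, P (Negz n) x}.
  by apply: ae_foralln => n; exact: aeP.
by apply: (ae_imp (ae_and p1 p2)) => x [h1 h2] [n|n].
Qed.

Lemma Linf_l2_square_summable f : Linf_l2 c f ->
  exists2 C, 0 <= C & ae_square_summable C f.
Proof.
move=> [mf]; rewrite /Linf_norm unlock.
set G := (fun x : R => \esum_(k in [set: int]) (cabs (f (x - k%:~R * c)%R) ^+ 2)%:E)%E.
(* The norm of exponent +oo is defined as an essential supremum only when the space has positive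
   measure. *)
have muT : (0 < mu [set: R])%E.
  apply: (@lt_le_trans _ _ (mu `[0, 1]%classic)).
    by rewrite lebesgue_measure_itv/= lte_fin ltr01 sube0 lte_fin.
  by apply: le_measure => //; rewrite inE; [exact: measurable_itv|exact: measurableT].
rewrite muT; set e := ess_sup_inf.ess_sup _ _ => eoo.
have aee : {ae mu, forall x : R, ((abse \o (G \_ `[0%R, c])) x <= e)%E} by exact: ess_sup_inf.ess_sup_ge.
pose C := Num.max 0 (fine e); exists C; first by rewrite le_max lexx.
have ae1 : {ae mu, forall x, `[0, c]%classic x -> forall A : {fset int},
    \sum_(k <- A) cabs (f (x - k%:~R * c)) ^+ 2 <= C}.
  apply: (ae_imp aee) => x xe xI A.
  have Gx : (G x <= e)%E.
    by apply: le_trans xe; rewrite /= patchE mem_set// lee_abs.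
  have SG := @le_sum_esum _ (fun k => cabs (f (x - k%:~R * c)) ^+ 2) A (fun k => sqr_ge0 _).
  have := le_trans SG Gx.
  rewrite /C; case: (e) eoo => [r| |]//= _.
  by rewrite lee_fin => h; rewrite (le_trans h)// le_max lexx orbT.
apply: (ae_imp (@ae_int (fun j x => `[0, c]%classic (x - j%:~R * c) -> forall A : {fset int},
    \sum_(k <- A) cabs (f (x - j%:~R * c - k%:~R * c)) ^+ 2 <= C) _)).
  by move=> j; exact: ae_translate ae1.
(* Subtracting [j * c] brings [x] into the period; the set of indices is shifted accordingly.
   Countably many translates of the exceptional null set suffice. *)
move=> x xP A; pose j := Num.floor (x / c).
have := xP j _ [fset k - j | k in A]%fset; rewrite big_imfset/=; last first.
  by move=> k l _ _ /addIr.
rewrite (eq_bigr (fun k => cabs (f (x - k%:~R * c)) ^+ 2)); last first.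
  move=> k _; congr (cabs (f _) ^+ 2); rewrite rmorphB/=; ring.
apply; rewrite in_itv/=.
have h1 : j%:~R <= x / c by exact: floor_le.
have h2 : x / c < (j + 1)%:~R by exact: floorD1_gt.
rewrite ler_pdivlMr// in h1; rewrite ltr_pdivrMr// rmorphD/= mulrDl mul1r in h2.
by apply/andP; split; lra.
Qed.

Lemma ae_square_summable_translation C f t : ae_square_summable C f ->
  ae_square_summable C (translation t f).
Proof.
move=> aef; apply: (ae_imp (ae_translate t aef)) => x h A.
by under eq_bigr do rewrite /translation addrAC; exact: h.
Qed.

Lemma sum_cabs_bterm_le f h x C D (A : {fset int}) :
  \sum_(k <- A) cabs (f (x - k%:~R * c)) ^+ 2 <= C ->
  \sum_(k <- A) cabs (h (x - k%:~R * c)) ^+ 2 <= D ->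
  \sum_(k <- A) cabs (bterm f h x k) <= C + D.
Proof.
move=> fC hD; apply: (le_trans _ (lerD fC hD)); rewrite -big_split/=.
apply: ler_sum => k _; rewrite /bterm.
have := @cabs_mulconj_le R 1 (f (x - k%:~R * c)) (h (x - k%:~R * c)) ltr01.
by rewrite invr1 !mul1r.
Qed.

End brackets.

(** * Unconditional sums of square-integrable functions and Gabor series *)

Section L2_sums.
Context {R : realType}.
Local Notation mu := (@lebesgue_measure R).

Lemma mulr_div_succ_le (r e : R) : 0 <= r -> 0 <= e -> r * (e / (r + 1)) <= e.
Proof.
move=> r0 e0; have r1 : 0 < r + 1 by rewrite ltr_wpDl.
by rewrite mulrA ler_pdivrMr//; nra.
Qed.

Lemma L2_sumZ (I : choiceType) (u : I -> R -> R[i]) s (r : R) : L2_sum u s ->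
  L2_sum (fun i x => r%:C * u i x) (fun x => r%:C * s x).
Proof.
move=> /L2_sumP[Lu Ls us]; apply/L2_sumP; split=> [i||e e0]; try exact: L2Z.
have r0 : 0 < r ^+ 2 + 1 by rewrite ltr_wpDl// sqr_ge0.
have [A0 A0P] := us _ (divr_gt0 e0 r0); exists A0 => A /A0P h.
rewrite (@eq_sqnorm _ _ (fun x => r%:C * (\sum_(i <- A) u i x - s x))); last first.
  by move=> x; rewrite mulrBr mulr_sumr.
rewrite sqnormZ; last first.
  by apply: cmeasurableB; [apply: cmeasurable_sum => i; exact: (L2_cmeas (Lu i))|exact: (L2_cmeas Ls)].
rewrite cabs_real real_normK ?num_real//.
apply: (@le_trans _ _ ((r ^+ 2)%:E * (e / (r ^+ 2 + 1))%:E)%E).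
  by apply: lee_wpmul2l h; rewrite lee_fin sqr_ge0.
by rewrite -EFinM lee_fin mulr_div_succ_le ?sqr_ge0// ltW.
Qed.

Lemma cabs_eq0 (z : R[i]) : cabs z = 0 -> z = 0.
Proof. by move=> z0; apply/eqP; rewrite -normr_eq0 norm_cabs z0. Qed.

Lemma L2_sum_unique (I : choiceType) (u : I -> R -> R[i]) s s' :
  L2_sum u s -> L2_sum u s' -> {ae mu, forall x, s x = s' x}.
Proof.
move=> /L2_sumP[Lu Ls us] /L2_sumP[_ Ls' us'].
have Ld := L2B Ls Ls'.
have mS A : cmeasurable (fun x => \sum_(i <- A) u i x).
  by apply: cmeasurable_sum => i; exact: (L2_cmeas (Lu i)).
have d0 : (sqnorm (fun x => s x - s' x)%R = 0)%E.
  apply/eqP; rewrite eq_le sqnorm_ge0 andbT; apply/lee_addgt0Pr => e e0; rewrite add0e.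
  have e40 : 0 < e / 4 by rewrite divr_gt0.
  have [A0 A0P] := us _ e40; have [A1 A1P] := us' _ e40.
  pose A := (A0 `|` A1)%fset.
  rewrite (@eq_sqnorm _ _ (fun x => (\sum_(i <- A) u i x - s' x) - (\sum_(i <- A) u i x - s x))); last first.
    by move=> x; rewrite opprB [RHS]addrC addrA subrK.
  apply: le_trans (sqnormB _ _) _.
  - exact: cmeasurableB (mS _) (L2_cmeas Ls').
  - exact: cmeasurableB (mS _) (L2_cmeas Ls).
  apply: (@le_trans _ _ (2%:E * (e / 4)%:E + 2%:E * (e / 4)%:E)%E).
    apply: leeD; rewrite lee_pmul2l// ?lte_fin//.
      by apply: A1P; exact: fsubsetUr.
    by apply: A0P; exact: fsubsetUl.
  by rewrite -!EFinM -EFinD lee_fin; lra.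
have mq : measurable_fun [set: R] (fun x => (cabs (s x - s' x) ^+ 2)%:E).
  by apply: measurable_sqr_cabs; exact: (L2_cmeas Ld).
have /(ae_eq_integral_abs mu measurableT mq) h :
    (\int[mu]_x `|(cabs (s x - s' x) ^+ 2)%:E| = 0)%E.
  by rewrite -[RHS]d0; apply: eq_integral => x _; rewrite gee0_abs// lee_fin sqr_ge0.
apply: (ae_imp h) => x /(_ Logic.I) [] /eqP; rewrite sqrf_eq0 => /eqP /cabs_eq0 /eqP.
by rewrite subr_eq0 => /eqP.
Qed.

Lemma sum_allpairs (I J : choiceType) (V : nmodType) (M : {fset I}) (N : {fset J})
    (F : I * J -> V) :
  \sum_(p <- [fset p in allpairs (fun j i => (i, j)) N M]%fset) F p =
  \sum_(j <- N) \sum_(i <- M) F (i, j).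
Proof.
transitivity (\sum_(p <- allpairs (fun j i => (i, j)) N M) F p); last first.
  by rewrite big_allpairs_dep.
apply: perm_big; apply: uniq_perm.
- exact: fset_uniq.
- by apply: allpairs_uniq; rewrite ?fset_uniq// => [[? ?] [? ?] _ _ [-> ->]].
- by move=> p; rewrite !inE.
Qed.

(** A finite set [N] of outer indices containing the projection of [A0] is completed to a rectangle
    containing [A0]. The error over [N] is then the error of the double sum minus the finitely many
    inner errors, so outer convergence is a conclusion. *)
Lemma L2_sum_iterated (I J : choiceType) (u : I * J -> R -> R[i]) (U : J -> R -> R[i]) s :
  L2_sum u s -> (forall j, L2_sum (fun i => u (i, j)) (U j)) -> L2_sum U s.
Proof.
move=> /L2_sumP[Lu Ls us] uU.
have LU j : L2 (U j) by have /L2_sumP[] := uU j.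
apply/L2_sumP; split => // e e0; have e40 : 0 < e / 4 by rewrite divr_gt0.
have [A0 A0P] := us _ e40.
exists [fset p.2 | p in A0]%fset => N NA.
(* The inner tolerance is fixed after [N] and cancels the constant 4^k of [sqnorm_sum_le]. *)
pose k := size N; pose d := (4 ^+ k)^-1 * (e / 4).
have d0 : 0 < d by rewrite mulr_gt0// invr_gt0 exprn_gt0.
have h j : {Mj : {fset I} | forall M : {fset I}, (Mj `<=` M)%fset ->
    (sqnorm (fun x => \sum_(i <- M) u (i, j) x - U j x)%R <= d%:E)%E}.
  by apply: cid; have /L2_sumP[_ _ /(_ _ d0)] := uU j.
pose M := ([fset p.1 | p in A0] `|` \bigcup_(j <- N) sval (h j))%fset.
pose A := [fset p in allpairs (fun j i => (i, j)) N M]%fset.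
have A0A : (A0 `<=` A)%fset.
  apply/fsubsetP => -[i j] pA; rewrite !inE; apply/allpairsP; exists (j, i) => /=; split => //.
    by apply: (fsubsetP NA); apply/imfsetP; exists (i, j).
  by rewrite inE; apply/orP; left; apply/imfsetP; exists (i, j).
have mu_ p : cmeasurable (u p) by exact: (L2_cmeas (Lu p)).
pose W j x := \sum_(i <- M) u (i, j) x - U j x.
have mW j : cmeasurable (W j).
  by apply: cmeasurableB; [exact: cmeasurable_sum|exact: (L2_cmeas (LU j))].
rewrite (@eq_sqnorm _ _ (fun x => (\sum_(p <- A) u p x - s x) - \sum_(j <- N) W j x)); last first.
  by move=> x; rewrite sum_allpairs /W sumrB; ring.
apply: le_trans (sqnormB _ _) _.
- by apply: cmeasurableB; [exact: cmeasurable_sum|exact: (L2_cmeas Ls)].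
- exact: cmeasurable_sum.
apply: (@le_trans _ _ (2%:E * (e / 4)%:E + 2%:E * (4 ^+ k * d)%:E)%E).
  apply: leeD; rewrite lee_pmul2l// ?lte_fin//; first exact: A0P.
  apply: sqnorm_sum_le => //; first exact: ltW.
  move=> j jN; apply: (svalP (h j)); apply: fsubset_trans (fsubsetUr _ _).
  exact: bigfcup_sup.
rewrite -!EFinM -EFinD lee_fin /d mulrA mulfV ?expf_neq0//; first by lra.
Qed.

End L2_sums.

(** * The sum over modulations for a single translate w *)

Section gabor_sums.
Context {R : realType} (b : R).
Context (b0 : 0 < b).
Local Notation mu := (@lebesgue_measure R).
Local Notation I := (`[0%R, b^-1[%classic : set R).

(* A bracket is bounded only almost everywhere; truncating it gives an
   everywhere bounded function that is still periodic. *)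
Definition truncate (K : R) (F : R -> R[i]) (x : R) : R[i] :=
  (\1_[set x | cabs (F x) <= K] x)%:C * F x.

Lemma truncateE K F x : cabs (F x) <= K -> truncate K F x = F x.
Proof. by move=> FK; rewrite /truncate indicE mem_set// mul1r. Qed.

Lemma eq_truncate K F x y : F x = F y -> truncate K F x = truncate K F y.
Proof.
move=> Fxy; rewrite /truncate !indicE Fxy; congr (_%:R%:C * _); congr nat_of_bool.
by apply/idP/idP => /set_mem /= h; apply/mem_set => /=; rewrite ?Fxy// -Fxy.
Qed.

Lemma truncate_le K F x : 0 <= K -> cabs (truncate K F x) <= K.
Proof.
move=> K0; rewrite cabsM cabs_real indicE.
have [/set_mem FK|_] := boolP (x \in _); first by rewrite normr1 mul1r.
by rewrite normr0 mul0r.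
Qed.

Lemma cmeasurable_truncate K F : cmeasurable F -> cmeasurable (truncate K F).
Proof.
move=> mF; apply: cmeasurableM => //; apply: cmeasurable_real; apply: measurable_indic.
rewrite (_ : [set x | _] = [set: R] `&` [set x | cabs (F x) <= K]); last by rewrite setTI.
have := measurable_cabs mF; move/(_ measurableT `]-oo, K]%classic (measurable_itv _)).
rewrite (_ : _ @^-1` _ = [set x | cabs (F x) <= K])//.
Qed.

Context (f w : R -> R[i]) (C D : R).
Context (Lf : L2 f) (Lw : L2 w).
Context (C0 : 0 <= C) (D0 : 0 <= D).
Context (fC : ae_square_summable b^-1 C f) (wD : ae_square_summable b^-1 D w).

Let F := bracket b^-1 f w.
Let F' := truncate (C + D) F.
Let bp : 0 < b^-1. Proof. by rewrite invr_gt0. Qed.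
Let CD0 : 0 <= C + D. Proof. exact: addr_ge0. Qed.

Let ae_bterm : {ae mu, forall x, forall A : {fset int},
  \sum_(k <- A) cabs (bterm b^-1 f w x k) <= C + D}.
Proof.
by apply: (ae_imp (ae_and fC wD)) => x [h1 h2] A; exact: sum_cabs_bterm_le.
Qed.

Let cabs_window_le x N : (forall A : {fset int},
    \sum_(k <- A) cabs (bterm b^-1 f w x k) <= C + D) ->
  cabs (\sum_(i < N) (bterm b^-1 f w x (Posz i) + bterm b^-1 f w x (Negz i))) <= C + D.
Proof.
move=> h; rewrite -sum_int_window; apply: le_trans (h (int_window N)).
exact: cabs_sum.
Qed.

Lemma ae_bracket_le : {ae mu, forall x, cabs (F x) <= C + D}.
Proof.
apply: (ae_imp ae_bterm) => x xCD.
have [c1 c2] := @sum_cvg _ (bterm b^-1 f w x) (ex_intro _ _ xCD).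
have := @cvg_sqr_cabsB _ _ 0 _ c1 c2; rewrite -bracketE sub0r cabsN => h.
suff : cabs (F x) ^+ 2 <= (C + D) ^+ 2 by rewrite ler_pXn2r// nnegrE cabs_ge0.
rewrite -(cvg_lim _ h)//; apply: limr_le; first by apply/cvg_ex; eexists; exact: h.
apply: nearW => N; rewrite sub0r cabsN lerXn2r ?nnegrE ?cabs_ge0//.
exact: cabs_window_le.
Qed.

Lemma ae_truncate_bracket : {ae mu, forall x, F' x = F x}.
Proof. by apply: (ae_imp ae_bracket_le) => x; exact: truncateE. Qed.

Let mF : cmeasurable F.
Proof. by apply: cmeasurable_bracket; [exact: (L2_cmeas Lf)|exact: (L2_cmeas Lw)]. Qed.

Let mF' : cmeasurable F'. Proof. exact: cmeasurable_truncate. Qed.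

(** The exponential has period 1/b, so it factors out of the periodisation of f conj(w) and leaves
    the bracket. *)
Lemma gabor_coefficient m : L2inner f (fun x => expi b m x * w x) =
  L2inner (fun x => cell b x * F' x) (expcell b m).
Proof.
pose Z x := f x * Num.conj (w x) * expi b (- m) x.
have iZ : cintegrable Z.
  apply: (@cintegrable_bounded_mul _ _ _ 1).
  - exact: cintegrable_mulconj.
  - by apply: cmeasurableM; [exact: (L2_cmeas Lf)|apply: cmeasurable_conj; exact: (L2_cmeas Lw)].
  - exact: cmeasurable_expi.
  - by move=> x; rewrite cabs_expi.
have bn0 : b != 0 by rewrite gt_eqF.
have ZE x k : Z (x - k%:~R * b^-1) = bterm b^-1 f w x k * expi b (- m) x.
  by rewrite /Z expi_periodic.
have SE x N : \sum_(i < N) (Z (x - (Posz i)%:~R * b^-1) + Z (x - (Negz i)%:~R * b^-1)) =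
    (\sum_(i < N) (bterm b^-1 f w x (Posz i) + bterm b^-1 f w x (Negz i))) * expi b (- m) x.
  by rewrite mulr_suml; apply: eq_bigr => i _; rewrite !ZE mulrDl.
have mL : cmeasurable (fun x => F' x * expi b (- m) x).
  by apply: cmeasurableM => //; exact: cmeasurable_expi.
(* Unfolding is stated for real functions; [p] stands for the real or the imaginary part, of which
   only additivity and contraction are used. *)
have aeC (p : R[i] -> R) : (forall z, `|p z| <= cabs z) ->
  (forall y z, p (y + z) = p y + p z) ->
  {ae mu, forall x, I x -> forall N : nat,
    `|\sum_(i < N) (p (Z (x - (Posz i)%:~R * b^-1)) + p (Z (x - (Negz i)%:~R * b^-1)))| <= C + D}.
  move=> p1 p2; apply: (ae_imp ae_bterm) => x xCD _ N.
  have p3 : p 0 = 0 by apply: (addrI (p 0)); rewrite -p2 !addr0.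
  under eq_bigr do rewrite -p2.
  rewrite -(big_morph p p2 p3) SE; apply: le_trans (p1 _) _.
  by rewrite cabsM cabs_expi mulr1; exact: cabs_window_le.
have cvgx := ae_and ae_bterm ae_truncate_bracket.
have E1 : Rintegral mu setT (fun x => complex.Re (Z x)) =
    Rintegral mu I (fun x => complex.Re (F' x * expi b (- m) x)).
  apply: (Rintegral_unfold bp iZ.1 mL.1 (aeC _ (@norm_Re_le R) (@ReD R))).
  apply: (ae_imp cvgx) => x [xCD FE] _.
  have [c1 c2] := @sum_cvg _ (bterm b^-1 f w x) (ex_intro _ _ xCD).
  under eq_fun => N.
    under eq_bigr do rewrite -ReD.
    rewrite -Re_sum SE ReM; over.
  by rewrite ReM FE; apply: cvgB; apply: cvgM => //; exact: cvg_cst.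
have E2 : Rintegral mu setT (fun x => complex.Im (Z x)) =
    Rintegral mu I (fun x => complex.Im (F' x * expi b (- m) x)).
  apply: (Rintegral_unfold bp iZ.2 mL.2 (aeC _ (@norm_Im_le R) (@ImD R))).
  apply: (ae_imp cvgx) => x [xCD FE] _.
  have [c1 c2] := @sum_cvg _ (bterm b^-1 f w x) (ex_intro _ _ xCD).
  under eq_fun => N.
    under eq_bigr do rewrite -ImD.
    rewrite -Im_sum SE ImM; over.
  by rewrite ImM FE; apply: cvgD; apply: cvgM => //; exact: cvg_cst.
have -> : L2inner f (fun x => expi b m x * w x) = cintegral Z.
  by apply: eq_cintegral => x; rewrite /Z rmorphM/= conj_expi; ring.
have -> : L2inner (fun x => cell b x * F' x) (expcell b m) =
    cintegral (fun x => cell b x * (F' x * expi b (- m) x)).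
  apply: eq_cintegral => x; rewrite /expcell rmorphM/= conj_cell conj_expi.
  by rewrite -[in RHS](cell_idem b x); ring.
apply: complexP => /=.
  rewrite E1 -Rintegral_cell; apply: eq_Rintegral => x _.
  by rewrite [in RHS]ReM /= mul0r subr0.
rewrite E2 -Rintegral_cell; apply: eq_Rintegral => x _.
by rewrite [in RHS]ImM /= mul0r addr0.
Qed.

Lemma L2_expi_mul m : L2 (fun x => expi b m x * w x).
Proof.
apply: le_L2 (Lw) _.
  by apply: cmeasurableM; [exact: cmeasurable_expi|exact: (L2_cmeas Lw)].
by move=> x; rewrite cabsM cabs_expi mul1r.
Qed.

Lemma L2_bracket_mul : L2 (fun x => F x * w x).
Proof.
have mw := L2_cmeas Lw.
have L' : L2 (fun x => F' x * w x).
  apply: (@le_L2 _ _ (fun x => (C + D)%:C * w x)); first exact: cmeasurableM.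
    exact: L2Z.
  move=> x; rewrite cabsM [leRHS]cabsM cabs_real (ger0_norm CD0).
  by apply: ler_wpM2r; [exact: cabs_ge0|exact: truncate_le].
apply/L2P; split; first exact: cmeasurableM.
rewrite (@ae_eq_sqnorm _ _ (fun x => F' x * w x)); first by have /L2P[] := L'.
- exact: cmeasurableM.
- exact: cmeasurableM.
- by apply: (ae_imp ae_truncate_bracket) => x ->.
Qed.

Lemma gabor_sum : L2_sum (fun m x =>
    L2inner f (fun y => expi b m y * w y) * (expi b m x * w x))
  (fun x => (b^-1)%:C * (F x * w x)).
Proof.
have mw := L2_cmeas Lw.
have /L2_sumP[_ _ Fs] := fourier_series_cvg b0 mF' (fun x => truncate_le F x CD0).
apply/L2_sumP; split=> [m||e e0].
- by apply: L2Z; exact: L2_expi_mul.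
- by apply: L2Z; exact: L2_bracket_mul.
(* Multiplication by [w] costs a factor [D], which may be 0; hence the division by [D + 1]. *)
have D1 : 0 < D + 1 by rewrite ltr_wpDl.
have [A0 A0P] := Fs _ (divr_gt0 e0 D1); exists A0 => A /A0P.
pose a m := L2inner (fun y => cell b y * F' y) (expcell b m).
(* The Fourier error continued periodically to the line. With the truncation [F'] it is exactly
   periodic, and multiplied by [w] it agrees almost everywhere with the error of the Gabor sum. *)
pose psi x := \sum_(m <- A) a m * expi b m x - (b^-1)%:C * F' x.
have mpsi : cmeasurable psi.
  apply: cmeasurableB.
    apply: cmeasurable_sum => m; apply: cmeasurableM; first exact: cmeasurable_cst.
    exact: cmeasurable_expi.
  by apply: cmeasurableM => //; exact: cmeasurable_cst.
rewrite (@eq_sqnorm _ _ (fun x => cell b x * psi x)); last first.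
  move=> x; rewrite /psi mulrBr mulr_sumr; congr (_ - _); last by ring.
  by apply: eq_bigr => m _; rewrite -/(a m) /expcell; ring.
move=> h.
rewrite (@ae_eq_sqnorm _ _ (fun x => psi x * w x)).
- apply: le_trans (sqnorm_periodic_mul b0 mpsi _ mw D0 _) _.
  + move=> k x; rewrite /psi; congr (_ - _).
      by apply: eq_bigr => m _; rewrite expi_periodic ?gt_eqF.
    by congr (_ * _); apply: eq_truncate; exact: bracket_periodic.
  + by apply: (ae_imp wD) => x h' N; rewrite -(sum_int_window (fun k => cabs (w (x - k%:~R * b^-1)) ^+ 2)).
  apply: (@le_trans _ _ (D%:E * (e / (D + 1))%:E)%E).
    by apply: lee_wpmul2l h; rewrite lee_fin.
  by rewrite -EFinM lee_fin mulr_div_succ_le// ltW.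
- apply: cmeasurableB.
    apply: cmeasurable_sum => m; apply: cmeasurableM; first exact: cmeasurable_cst.
    by apply: cmeasurableM => //; exact: cmeasurable_expi.
  by apply: cmeasurableM; [exact: cmeasurable_cst|exact: cmeasurableM].
- exact: cmeasurableM.
- apply: (ae_imp ae_truncate_bracket) => x FE.
  rewrite /psi FE mulrBl mulr_suml -mulrA; congr (_ - _).
  by apply: eq_bigr => m _; rewrite gabor_coefficient -/(a m) mulrA.
Qed.

End gabor_sums.

(** The case of the constant multiplier 1 in [sqnorm_periodic_mul]. *)
Lemma Linf_l2_L2 (R : realType) (b : R) (f : R -> R[i]) : 0 < b ->
  Linf_l2 b^-1 f -> L2 f.
Proof.
move=> b0 [mf foo]; have bp : 0 < b^-1 by rewrite invr_gt0.
have [C C0 fC] := Linf_l2_square_summable bp (conj mf foo).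
have c1 (x : R) : cabs (1 : R[i]) <= 1 by rewrite cabsE /= expr0n addr0 expr1n sqrtr1.
apply/L2P; split => //.
rewrite (@eq_sqnorm _ _ (fun x => 1 * f x)); last by move=> x; rewrite mul1r.
apply: le_lt_trans (@sqnorm_periodic_mul _ _ b0 (fun=> 1) f C _ _ mf C0 _) _ => //.
- by apply: (ae_imp fC) => x h N; rewrite -(sum_int_window (fun k => cabs (f (x - k%:~R * b^-1)) ^+ 2)).
apply: (@le_lt_trans _ _ (C%:E * (1 ^+ 2 * b^-1)%:E)%E); last by rewrite -EFinM ltry.
apply: lee_wpmul2l; first by rewrite lee_fin.
by apply: sqnorm_cell_bounded.
Qed.

Lemma gabor_bessel_family (R : realType) (g : R -> R[i]) (a b : R) :
  gabor_bessel g a b -> exists2 B, 0 < B & bessel_family (gabor g a b) B.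
Proof.
move=> [B B0 gB]; exists B => // f Lf A.
rewrite -lee_fin EFinM (fineK (sqnorm_fin Lf)) -L2norm_sqr.
apply: le_trans (gB f Lf).
by apply: le_sum_esum => mn; exact: sqr_ge0.
Qed.

Theorem theorem6p16 (R : realType) (g : R -> R[i]) (a b : R)
  (g_L2 : L2 g) (a_gt0 : 0 < a) (b_gt0 : 0 < b)
  (g_bessel : gabor_bessel g a b)
  (g_Xb : XLinf_l2 b^-1 g) (g_Xa : XLinf_l2 a g)
  (f : R -> R[i]) (f_Xb : XLinf_l2 b^-1 f) :
  exists2 s : R -> R[i],
    L2_sum (fun (n : int) (x : R) =>
      bracket b^-1 f (translation (n%:~R * a) g) x
        * translation (n%:~R * a) g x) s &
    {ae @lebesgue_measure R, forall x, frame_operator g a b f x = (b^-1)%:C * s x}.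
Proof.
have bp : 0 < b^-1 by rewrite invr_gt0.
have [C C0 fC] := Linf_l2_square_summable bp f_Xb.1.
have [D D0 gD] := Linf_l2_square_summable bp g_Xb.1.
have Lf := Linf_l2_L2 b_gt0 f_Xb.1.
pose w (n : int) := translation (n%:~R * a) g.
have Lw n : L2 (w n) by exact: L2_translation.
have wD n : ae_square_summable b^-1 D (w n) by exact: ae_square_summable_translation.
have Lgab mn : L2 (gabor g a b mn) by case: mn => m n; exact: (L2_expi_mul b (Lw n) m).
have [B B0 gB] := gabor_bessel_family g_bessel.
have [s0 s0P] := bessel_L2_sum B0 Lgab gB Lf.
have inner n : L2_sum (fun m x => L2inner f (gabor g a b (m, n)) * gabor g a b (m, n) x)
    (fun x => (b^-1)%:C * (bracket b^-1 f (w n) x * w n x)).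
  exact: (gabor_sum b_gt0 Lf (Lw n) C0 D0 fC (wD n)).
have bn0 : b%:C * (b^-1)%:C = 1 :> R[i] by rewrite -rmorphM/= mulfV ?gt_eqF.
(* The iterated sum carries the factor 1/b in each term, so the series without it sums to [b] times
   the sum [s0] of the double series. *)
exists (fun x => b%:C * s0 x).
  have := L2_sumZ b (L2_sum_iterated s0P inner).
  congr (L2_sum _ _); apply/funext => n; apply/funext => x.
  by rewrite mulrA bn0 mul1r.
(* As a sum exists, [xget] returns one; it agrees with [s0] only up to a null set. *)
have fo : L2_sum (fun mn x => L2inner f (gabor g a b mn) * gabor g a b mn x)
    (frame_operator g a b f).
  by rewrite /frame_operator; apply: xgetPex; exists s0.
apply: (ae_imp (L2_sum_unique fo s0P)) => x ->.
by rewrite mulrA [X in X * _]mulrC bn0 mul1r.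
Qed.
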